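(* Let $\mathbf E$ be a Banach space over $\mathbb K$ with a normalized $1$-unconditional basis $(\mathbf e_i)_{i\in\mathbb N}$. Assume that $(\mathbf e_i)$ is strictly $1$-unconditional, and that one of the following holds: - $\mathbb K=\mathbb R$ and for any $j\neq k$ in $\mathbb N$, if $T:\mathrm{span}(\mathbf e_j^*,\mathbf e_k^* )\to\mathbf E^*$ is a linear isometric embedding, then $T\mathbf e_j^*$ and $T\mathbf e_k^*$ have disjoint supports; or - $\mathbb K=\mathbb C$ and $\mathrm{span}(\mathbf e_j^*,\mathbf e_k^* )$ is not isometrically equal to $\ell_2(2)$ for any $j\neq k$. Moreover, assume that for any finite set $F\subset\mathbb N$, the extreme points of the unit ball of $\mathrm{span}(\mathbf e_i^*;\ i\in F)$ cannot be covered by finitely many hyperplanes of $\mathrm{span}(\mathbf e_i^*;\ i\in F)$. Then, if $\mathcal F_1$ and $\mathcal F_2$ are compact combinatorial families, any isometry $J:X_{\mathcal F_1,\mathbf E}^*\to X_{\mathcal F_2,\mathbf E}^*$ is an $(\mathcal F_1,\mathcal F_2)$-compatible signed permutation of $(e_i^* )$.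
   Context: $\mathbb N=\{1,2,\dots\}$; ''isometry'' means linear surjective isometry; a sign is a scalar of modulus $1$. $(\mathbf e_i^* )$ denotes the coordinate functionals of $(\mathbf e_i)$; spans of the $\mathbf e_i^*$ carry the norm of $\mathbf E^*$. Hyperplanes are linear (codimension-one linear subspaces). The support of $\mathbf z^*\in\mathbf E^*$ is $\{i;\langle\mathbf z^*,\mathbf e_i\rangle\neq0\}$. $(\mathbf e_i)$ is strictly $1$-unconditional if whenever $(a_i),(b_i)\in c_{00}$ satisfy $|a_i|\leqslant|b_i|$ for all $i$ with at least one strict inequality, then $\|\sum a_i\mathbf e_i\|_{\mathbf E}<\|\sum b_i\mathbf e_i\|_{\mathbf E}$. For vectors $u,v$ of a normed space, $\mathrm{span}(u,v)$ is isometrically equal to $\ell_2(2)$ if $\|au+bv\|^2=|a|^2+|b|^2$ for all scalars $a,b$. A combinatorial family is a family $\mathcal F$ of finite subsets of $\mathbb N$ containing all singletons and hereditary for inclusion; it is compact if closed in $\{0,1\}^{\mathbb N}$. $c_{00}$ is the space of finitely supported scalar sequences with canonical basis $(e_i)$. $X_{\mathcal F,\mathbf E}$ is the completion of $c_{00}$ for the norm $\|x\|_{\mathcal F,\mathbf E}=\sup\{\|\sum_{i\in F}x(i)\mathbf e_i\|_{\mathbf E};F\in\mathcal F\}$; $(e_i)$ is a $1$-unconditional basis of it, with coordinate functionals $(e_i^* )$, which form a basis of $X_{\mathcal F,\mathbf E}^*$ when $\mathcal F$ is compact. $J$ is an $(\mathcal F_1,\mathcal F_2)$-compatible signed permutation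 of $(e_i^* )$ if there are signs $(\omega_i)$ and a permutation $\pi$ of $\mathbb N$ with $\pi(\mathcal F_1):=\{\pi(F);F\in\mathcal F_1\}=\mathcal F_2$ such that $Je_i^*=\omega_ie_{\pi(i)}^*$ for all $i$. *)

(* Defs.v *)
From HB Require Import structures.
From mathcomp Require Import all_boot all_order all_algebra finmap complex.
From mathcomp Require Import all_classical all_reals all_analysis.

Set Implicit Arguments.
Unset Strict Implicit.
Unset Printing Implicit Defensive.

Import Order.TTheory GRing.Theory Num.Theory.
Import numFieldNormedType.Exports.

Local Open Scope classical_set_scope.
Local Open Scope ring_scope.

(* Everything is developed over an arbitrary [K : numFieldType], to be used
   with [K] the real or the complex field.  Norms take their values in [K], and
   suprema of norms are taken with [supremum] for the partial order of [K]: in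
   the complex field, an upper bound of a nonempty set of nonnegative reals is
   itself real, so this is the usual supremum of reals.  The set of natural
   numbers starts at 0 and only serves as a countable index set. *)

Section dual.
Variables (K : numFieldType) (X : normedModType K).

Definition continuous_linear : {pred X -> K^o} :=
  mem [set f : X -> K^o | linear f /\ continuous f].

Lemma continuous_linear_submod_closed : submod_closed continuous_linear.
Proof.
split=> [|a f g].
  rewrite inE; split; first by move=> a x y /=; rewrite scaler0 addr0.
  by move=> x; exact: (@cst_continuous _ _ (0 : K^o)).
rewrite !inE => -[lf cf] [lg cg]; split.
  move=> b x y.
  rewrite !fctE /= (lf b x y) (lg b x y) !scalerDr !scalerA (mulrC a).
  by rewrite addrACA.
move=> x; apply: (@continuousD _ _ _ (a *: f) g); last exact: cg.
by apply: (@continuousZl_tmp _ _ _ f a x); exact: cf.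
Qed.

HB.instance Definition _ := GRing.isSubmodClosed.Build K (X -> K^o)
  continuous_linear continuous_linear_submod_closed.

Record dual := Dual {
  dual_fun :> X -> K^o;
  dual_funP : dual_fun \in continuous_linear }.

HB.instance Definition _ := [isSub for dual_fun].
HB.instance Definition _ := [Choice of dual by <:].
HB.instance Definition _ := [SubChoice_isSubLmodule of dual by <:].

Lemma dual_linear (f : dual) : linear (f : X -> K^o).
Proof. by have /set_mem[] := dual_funP f. Qed.

HB.instance Definition _ (f : dual) :=
  GRing.isLinear.Build K X K^o _ (dual_fun f) (dual_linear f).

Lemma dual_continuous (f : dual) : continuous (f : X -> K^o).
Proof. by have /set_mem[] := dual_funP f. Qed.

Definition dual_norm (f : dual) : K :=
  supremum 0 [set `|f x| | x in [set x : X | `|x| <= 1]].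

End dual.

Section linear_geometry.
Variables (K : numFieldType) (V : lmodType K).

Definition is_subspace (W : set V) : Prop :=
  W 0 /\ forall (a : K) (x y : V), W x -> W y -> W (a *: x + y).

Definition lspan (S : set V) : set V := smallest is_subspace S.

(* [H] is a linear subspace of codimension one in [W]. *)
Definition hyperplane (W H : set V) : Prop :=
  [/\ is_subspace H, H `<=` W &
      exists v, [/\ W v, ~ H v &
        forall x, W x -> exists a : K, H (x - a *: v)]].

Definition extreme_points (B : set V) : set V :=
  [set x | B x /\ forall (y z : V) (t : K), B y -> B z -> 0 < t < 1 ->
    x = t *: y + (1 - t) *: z -> y = x /\ z = x].

End linear_geometry.

Section bases.
Variables (K : numFieldType) (E : normedModType K) (e : nat -> E).

Definition c00 : Type := {fsfun nat -> K with 0}.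

Definition lincomb (x : c00) : E := \sum_(i <- finsupp x) x i *: e i.

Definition schauder_basis : Prop :=
  forall x : E, exists! a : nat -> K, series (fun i => a i *: e i) @ \oo --> x.

Definition normalized : Prop := forall i, `|e i| = 1.

Definition one_unconditional : Prop :=
  forall (A : {fset nat}) (a w : nat -> K), (forall i, `|w i| = 1) ->
    `|\sum_(i <- A) (w i * a i) *: e i| = `|\sum_(i <- A) a i *: e i|.

Definition strictly_one_unconditional : Prop :=
  forall a b : c00, (forall i, `|a i| <= `|b i|) ->
    (exists i, `|a i| < `|b i|) -> `|lincomb a| < `|lincomb b|.

(* The continuous functional biorthogonal to the [e j]; when [e] is a Schauder
   basis it exists, and it is unique since the [e j] span a dense subspace. *)
Definition coordf (i : nat) : dual E :=
  xget 0 [set f : dual E | forall j, f (e j) = (i == j)%:R].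

Definition support (f : dual E) : set nat := [set i | f (e i) != 0].

Definition coord_span (A : set nat) : set (dual E) :=
  lspan [set coordf i | i in A].

(* Only the restriction of [T] to the span matters. *)
Definition embeddings_disjoint_supports : Prop :=
  forall j k : nat, j <> k -> forall T : dual E -> dual E,
    (forall (a : K) (f g : dual E),
      coord_span [set j; k] f -> coord_span [set j; k] g ->
      T (a *: f + g) = a *: T f + T g) ->
    (forall f, coord_span [set j; k] f -> dual_norm (T f) = dual_norm f) ->
    support (T (coordf j)) `&` support (T (coordf k)) = set0.

Definition isometrically_l2_2 (u v : dual E) : Prop :=
  forall a b : K, dual_norm (a *: u + b *: v) ^+ 2 = `|a| ^+ 2 + `|b| ^+ 2.

Definition no_l2_2_span : Prop :=
  forall j k : nat, j <> k -> ~ isometrically_l2_2 (coordf j) (coordf k).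

Definition extreme_points_not_covered : Prop :=
  forall (A : {fset nat}) (n : nat) (H : 'I_n -> set (dual E)),
    (forall i, hyperplane (coord_span [set` A]) (H i)) ->
    ~ (extreme_points
         (coord_span [set` A] `&` [set f : dual E | dual_norm f <= 1])
       `<=` \bigcup_(i in [set: 'I_n]) H i).

End bases.

Definition combinatorial_family (F : set {fset nat}) : Prop :=
  (forall i, F [fset i]%fset) /\
  (forall A B : {fset nat}, (A `<=` B)%fset -> F B -> F A).

Definition indicator (A : {fset nat}) : cantor_space := fun i => i \in A.

Definition compact_family (F : set {fset nat}) : Prop :=
  closed [set indicator A | A in F].

Definition family_norm (K : numFieldType) (E : normedModType K) (e : nat -> E)
    (F : set {fset nat}) (x : c00 K) : K :=
  supremum 0 [set `|\sum_(i <- A) x i *: e i| | A in F].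

(* [X] together with [u] is the completion of [c00] for [family_norm e F]: the
   linear map sending the [i]-th canonical vector to [u i] is isometric and has
   dense range in the complete space [X].  This determines [X] and [u] up to
   isometry. *)
Definition is_family_space (K : numFieldType) (E : normedModType K)
    (e : nat -> E) (F : set {fset nat}) (X : completeNormedModType K)
    (u : nat -> X) : Prop :=
  (forall x : c00 K, `|lincomb u x| = family_norm e F x) /\
  dense (range (lincomb u)).

Definition surjective_isometry (K : numFieldType) (X Y : normedModType K)
    (J : {linear dual X -> dual Y}) : Prop :=
  (forall f, dual_norm (J f) = dual_norm f) /\ (forall g, exists f, J f = g).

Definition compatible_signed_permutation (K : numFieldType)
    (X1 X2 : normedModType K) (F1 F2 : set {fset nat})
    (u1 : nat -> X1) (u2 : nat -> X2) (J : dual X1 -> dual X2) : Prop :=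
  exists (w : nat -> K) (p : nat -> nat),
    [/\ forall i, `|w i| = 1, bijective p,
        [set [fset p i | i in A]%fset | A in F1] = F2 &
        forall i, J (coordf u1 i) = w i *: coordf u2 (p i)].

(* Main.v *)
(* Let A be a maximal member of F1 and x a vector of E whose support is exactly A.
   By strictness, every functional of norm at most 1 on X1 that is norming for x
   is supported in A.  If the functionals J f, f supported in A, were not all
   supported in one member of F2, then by compactness a finite set D outside F2
   would be contained in the union of their supports.  Every member of F2 misses a
   point of D, so by Hahn-Banach a functional of norm 1 on X2 is a sum of
   functionals h_j, j in D, with h_j vanishing at j and with norms adding up to at
   most 1; applied to J f, f norming for x, this yields another functional norming
   for x, supported in A and lying in one of the finitely many hyperplanes
   {f : (J f)(j) = 0}.  As such x are dense, the same decomposition shows that the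
   extreme points of the unit ball of span(e_i^*, i in A) are covered by these
   hyperplanes, which is excluded.  Hence J and its inverse exchange the spans of
   maximal members of F1 and F2.

   It remains to see that each J e_i^* is supported at one point.  In the real case
   the hypothesis gives disjoint supports and invertibility concludes.  In the
   complex case (Kalton and Wood), the rank one operator J (e_i^* (x) e_i) J^-1 is
   Hermitian; if J e_i^* had two points m, l in its support, this would force the
   supporting functionals of span(e_m, e_l) to be those of a Euclidean norm. *)
From HB Require Import structures.
Require Import Defs.
From mathcomp Require Import all_boot all_order all_algebra finmap complex.
From mathcomp Require Import all_classical all_reals all_analysis.
From mathcomp Require Import ring lra.

Set Implicit Arguments.
Unset Strict Implicit.
Unset Printing Implicit Defensive.

Import Order.TTheory GRing.Theory Num.Theory.
Import numFieldNormedType.Exports.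

Local Open Scope classical_set_scope.
Local Open Scope ring_scope.

(** * Scalars and the Hahn-Banach theorem *)

(* The properties common to the real and the complex field that the proof uses:
   a real part, an embedding of the reals, and [re_ext], by which a real-linear
   functional is the real part of a [K]-linear one. *)
Record real_structure (R : realType) (K : numFieldType) := RealStructure {
  emb : {rmorphism R -> K};
  re : {additive K -> R};
  re_embM : forall r z, re (emb r * z) = r * re z;
  re1 : re 1 = 1;
  emb_ge0 : forall r, (0 <= emb r) = (0 <= r);
  re_ge0K : forall z, 0 <= z -> emb (re z) = z;
  re_le_norm : forall z, re z <= re `|z|;
  re_ext : forall (V : lmodType K) (g : V -> R),
    (forall v w, g (v + w) = g v + g w) ->
    (forall r v, g (emb r *: v) = r * g v) ->
    exists G : {linear V -> K^o}, forall v, re (G v : K) = g v }.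

Section real_structures.
Variable R : realType.

Lemma real_structure_real : real_structure R R.
Proof.
apply: (@RealStructure R R idfun idfun) => //=.
- by move=> z; exact: ler_norm.
- move=> V g gD gZ.
  have gl : linear (g : V -> R^o) by move=> a v w; rewrite gD gZ.
  pose m := GRing.isLinear.Build R V R^o _ (g : V -> R^o) gl.
  by exists (HB.pack_for {linear V -> R^o} (g : V -> R^o) m).
Defined.

(** A real-linear [g] is the real part of [v |-> g v - i g (i v)], which is complex-linear. *)
Lemma real_structure_complex : real_structure R R[i].
Proof.
have Re_add : additive (@complex.Re R : R[i] -> R) by move=> [a b] [c d].
pose reA := HB.pack_for {additive R[i] -> R} (@complex.Re R : R[i] -> R)
  (GRing.isAdditive.Build R[i] R _ Re_add).
apply: (@RealStructure R R[i] (real_complex R) reA) => //=.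
- by move=> r [a b] /=; rewrite mul0r subr0.
- by move=> r; rewrite ler0c.
- by move=> [a b]; rewrite lecE /= => /andP[/eqP-> _].
- case=> a b; rewrite (le_trans (ler_norm _))//.
  by rewrite -sqrtr_sqr ler_wsqrtr// lerDl sqr_ge0.
- move=> V g gD gZ.
  have gN v : g (- v) = - g v.
    by rewrite -scaleN1r -(rmorphN1 (real_complex R)) gZ mulN1r.
  pose G v : R[i] := Complex (g v) (- g ('i%C *: v)).
  have Gl : linear (G : V -> R[i]^o).
    move=> [a b] v w; rewrite /G.
    have -> : Complex a b = a%:C%C + 'i%C * b%:C%C.
      exact: (complexE (Complex a b)).
    have gi x : g ('i%C *: ('i%C *: x)) = - g x.
      by rewrite scalerA -expr2 sqr_i scaleN1r gN.
    rewrite !scalerDr !gD !scalerDl -!scalerA !scalerDr !gD.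
    have sC (c d : R[i]) (x : V) : c *: (d *: x) = d *: (c *: x).
      by rewrite !scalerA mulrC.
    rewrite !(sC 'i%C _%:C%C).
    rewrite !gZ gi; apply/eqP; rewrite eq_complex /=.
    by apply/andP; split; apply/eqP; ring.
  pose m := GRing.isLinear.Build R[i] V R[i]^o _ (G : V -> R[i]^o) Gl.
  by exists (HB.pack_for {linear V -> R[i]^o} (G : V -> R[i]^o) m).
Defined.

End real_structures.

Section scalars.
Variables (R : realType) (K : numFieldType) (S : real_structure R K).
Local Notation emb := (emb S).
Local Notation re := (re S).

Lemma re_emb r : re (emb r) = r.
Proof. by rewrite -[emb r]mulr1 re_embM re1 mulr1. Qed.

Lemma emb_le r s : (emb r <= emb s) = (r <= s).
Proof. by rewrite -subr_ge0 -rmorphB emb_ge0 subr_ge0. Qed.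

Lemma emb_lt r s : (emb r < emb s) = (r < s).
Proof. by rewrite !lt_def emb_le (can_eq re_emb). Qed.

Lemma emb_norm (z : K) : emb (re `|z|) = `|z|.
Proof. exact: re_ge0K. Qed.

Lemma re_norm_ge0 (V : normedZmodType K) (z : V) : 0 <= re `|z|.
Proof. by rewrite -(emb_ge0 S) re_ge0K. Qed.

Lemma emb_normv (V : normedZmodType K) (z : V) : emb (re `|z|) = `|z|.
Proof. exact: re_ge0K. Qed.

Lemma le_re z w : z <= w -> re z <= re w.
Proof.
rewrite -subr_ge0 => zw0; rewrite -subr_ge0 -raddfB /=.
by rewrite -(emb_ge0 S) re_ge0K.
Qed.

Lemma re_mulnorm (z : K) w : 0 <= z -> re (z * w) = re z * re w.
Proof. by move=> /(re_ge0K S) {1}<-; rewrite re_embM. Qed.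

Lemma re_norm_dist (V : normedZmodType K) (y z : V) :
  re `|y| <= re `|z| + re `|y - z|.
Proof. by rewrite -raddfD/= le_re// -{1}(subrK z y) addrC ler_normD. Qed.

Lemma rotation (z : K) : exists2 w : K, `|w| = 1 & w * z = `|z|.
Proof.
have [->|z0] := eqVneq z 0; first by exists 1; rewrite ?normr1 ?mulr0 ?normr0.
exists (`|z| / z); last by rewrite divfK.
by rewrite normrM normfV normr_id divff ?normr_eq0.
Qed.

End scalars.

Section hahn_banach.
Variables (R : realType) (K : numFieldType) (S : real_structure R K).
Local Notation emb := (emb S).
Local Notation re := (re S).
Variables (V : lmodType K) (p : V -> R).
Hypothesis pD : forall v w, p (v + w) <= p v + p w.
Hypothesis pZ : forall c v, p (c *: v) = re `|c| * p v.

Let p_emb r v : 0 <= r -> p (emb r *: v) = r * p v.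
Proof. by move=> r0; rewrite pZ ger0_norm ?emb_ge0// re_emb. Qed.

(* A real functional is identified with its graph; domination by [p] makes a
   subspace of [V * R] single-valued. *)
Let dominated (G : set (V * R)) :=
  (forall v r w s a, G (v, r) -> G (w, s) -> G (emb a *: v + w, a * r + s)) /\
  (forall v r, G (v, r) -> r <= p v).

Let dominated_inj G v r s : dominated G -> G (v, r) -> G (v, s) -> r = s.
Proof.
move=> [Glin Gp].
have le r' s' : G (v, r') -> G (v, s') -> r' <= s'.
  move=> Gr Gs; have := Gp _ _ (Glin _ _ _ _ (-1) Gs Gr).
  rewrite rmorphN1 scaleN1r addNr -(scale0r v) pZ normr0 raddf0 mul0r.
  by rewrite mulN1r addrC subr_le0.
by move=> Gr Gs; apply/eqP; rewrite eq_le !le.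
Qed.

(** Subadditivity puts every [r - p (v - w)] below every [p (v' + w) - r'], and the supremum [c] of
    the former serves as the value at [w]. Other multiples of [w] reduce to these bounds by
    homogeneity. *)
Let dominated_extend G w : dominated G -> G (0, 0) ->
  (forall r, ~ G (w, r)) ->
  exists c, dominated [set vr | exists v r a, G (v, r) /\
    vr = (v + emb a *: w, r + a * c)].
Proof.
move=> [Glin Gp] G0 Gw.
pose A := [set x | exists v r, G (v, r) /\ x = r - p (v - w)].
have Aub v r : G (v, r) -> ubound A (p (v + w) - r).
  move=> Gvr _ [v' [r' [Gvr' ->]]].
  rewrite lerBrDr addrAC lerBlDr addrC.
  have := Gp _ _ (Glin _ _ _ _ 1 Gvr Gvr').
  rewrite rmorph1 scale1r mul1r => /le_trans; apply.
  rewrite (_ : v + v' = (v + w) + (v' - w)); first exact: pD.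
  by rewrite addrACA subrr addr0.
have supA : has_sup A.
  split; first by exists (0 - p (0 - w)), 0, 0.
  by exists (p (0 + w) - 0); exact: Aub.
pose c := sup A.
have cub v r : G (v, r) -> c <= p (v + w) - r.
  by move=> Gvr; apply: ge_sup; [case: supA|exact: Aub].
have clb v r : G (v, r) -> r - p (v - w) <= c.
  by move=> Gvr; apply: ub_le_sup; [case: supA|exists v, r].
have Gscale v r a : G (v, r) -> G (emb a *: v, a * r).
  by move=> Gvr; have := Glin _ _ _ _ a Gvr G0; rewrite !addr0.
exists c; split=> [_ _ _ _ a [v [r [b [Gv [-> ->]]]]] [v' [r' [b' [Gv' [-> ->]]]]]|].
  exists (emb a *: v + v'), (a * r + r'), (a * b + b'); split; first exact: Glin.
  rewrite rmorphD rmorphM/= scalerDr scalerDl scalerA; congr pair.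
    by rewrite addrACA.
  by ring.
move=> _ _ [v [r [a [Gv [-> ->]]]]].
have [->|a0|a0] : [\/ a = 0, 0 < a | a < 0].
  by case: (ltgtP a 0) => ?; [apply: Or33|apply: Or32|apply: Or31].
- by rewrite rmorph0 scale0r mul0r !addr0; exact: Gp.
- have := cub _ _ (Gscale _ _ a^-1 Gv).
  rewrite -(ler_pM2l a0) mulrBr mulrA divff ?gt_eqF// mul1r lerBrDl.
  rewrite -(p_emb _ (ltW a0)) scalerDr scalerA -rmorphM/= divff ?gt_eqF//.
  by rewrite rmorph1 scale1r.
- have na0 : 0 < - a by rewrite oppr_gt0.
  have := clb _ _ (Gscale _ _ (- a^-1) Gv).
  rewrite -(ler_pM2l na0) mulrBr mulrA mulrNN divff ?lt_eqF// mul1r.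
  rewrite -(p_emb _ (ltW na0)) scalerDr scalerA -rmorphM/= mulrNN divff ?lt_eqF//.
  rewrite rmorph1 scale1r rmorphN/= scalerN scaleNr opprK.
  by rewrite mulNr; lra.
Qed.

Lemma real_hahn_banach (G0 : set (V * R)) : dominated G0 -> G0 (0, 0) ->
  exists g : V -> R, [/\ forall v w, g (v + w) = g v + g w,
    forall r v, g (emb r *: v) = r * g v,
    forall v, g v <= p v & forall v r, G0 (v, r) -> g v = r].
Proof.
move=> domG0 G00.
(* The empty chain has empty union, so containing [G0] is demanded of nonempty graphs only;
   maximality rules out the empty graph, as [G0] itself is admissible. *)
have [|G [[domG Gne] Gmax]] :=
    @Zorn_bigcup _ [set G | dominated G /\ (G !=set0 -> G0 `<=` G)].
  move=> F FP Ftot; split; last first.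
    move=> [vr [A FA Avr]] x G0x; exists A => //.
    by have [_ AG0] := FP _ FA; exact: (AG0 (ex_intro _ vr Avr)).
  split=> [v r w s a [A FA Av] [B FB Bw]|v r [A FA Av]]; last first.
    by have [[_ Ap] _] := FP _ FA; exact: Ap Av.
  have [AB|BA] := Ftot _ _ FA FB.
    exists B => //; have [[Blin _] _] := FP _ FB.
    by apply: Blin => //; exact: AB.
  exists A => //; have [[Alin _] _] := FP _ FA.
  by apply: Alin => //; exact: BA.
have G0G : G0 `<=` G.
  apply: Gne; apply: contrapT => G0'; apply: (Gmax G0 _ (conj domG0 (fun _ _ h => h))).
  split; first by move=> x Gx; exfalso; apply: G0'; exists x.
  by move=> /(_ _ G00) Gx; apply: G0'; exists (0, 0).
have Gtot w : exists r, G (w, r).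
  apply: contrapT => /forallNP Gw.
  have G00' := G0G _ G00.
  have [c domG'] := dominated_extend domG G00' Gw.
  apply: (Gmax _ _ (conj domG' _)); last first.
    move=> _ [v r] /G0G Gvr; exists v, r, 0; split=> //.
    by rewrite rmorph0 scale0r mul0r !addr0.
  split.
    move=> [v r] Gvr; exists v, r, 0; split=> //.
    by rewrite rmorph0 scale0r mul0r !addr0.
  move=> /(_ (w, c)) /(_ _)/Gw; apply; exists 0, 0, 1; split=> //.
  by rewrite rmorph1 scale1r mul1r !add0r.
pose g w := projT1 (cid (Gtot w)).
have Gg w : G (w, g w) by exact: projT2 (cid (Gtot w)).
have [Glin Gp] := domG.
have G00' := G0G _ G00.
exists g; split=> [v w|r v|v|v r /G0G Gvr].
- apply: (dominated_inj domG (Gg _)).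
  by have := Glin _ _ _ _ 1 (Gg v) (Gg w); rewrite rmorph1 scale1r mul1r.
- apply: (dominated_inj domG (Gg _)).
  by have := Glin _ _ _ _ r (Gg v) G00'; rewrite !addr0.
- exact: Gp.
- exact: (dominated_inj domG (Gg _)).
Qed.

(** The real theorem is applied to the graph of real parts, and [re_ext] restores linearity over
    [K]. A scalar of modulus 1 turns a modulus into a real part, which gives both the equality on
    [G0] and the bound by [p]. *)
Lemma hahn_banach (G0 : V -> K -> Prop) : G0 0 0 ->
  (forall a v k w l, G0 v k -> G0 w l -> G0 (a *: v + w) (a * k + l)) ->
  (forall v k, G0 v k -> re `|k| <= p v) ->
  exists g : {linear V -> K^o},
    (forall v k, G0 v k -> g v = k) /\ (forall v, re `|g v : K| <= p v).
Proof.
move=> G00 G0lin G0p.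
have [||g [gD gZ gp gG0]] :=
    @real_hahn_banach [set vr | exists2 k, G0 vr.1 k & vr.2 = re k].
- split=> [v r w s a [/= k Gk ->] [/= l Gl ->]|v r [/= k Gk ->]].
    by exists (emb a * k + l); [exact: G0lin|rewrite raddfD/= re_embM].
  by rewrite (le_trans (re_le_norm _ _))// G0p.
- by exists 0 => //=; rewrite raddf0.
have [G Gg] := re_ext gD gZ.
exists G; split=> [v k Gk|v].
  have [w w1 wk] := rotation (G v - k).
  have : re (w * (G v - k)) = 0.
    rewrite mulrBr raddfB/= (_ : w * G v = G (w *: v)); last by rewrite linearZ.
    rewrite Gg (gG0 (w *: v) (re (w * k))) ?subrr//.
    by exists (w * k) => //; have := G0lin w _ _ _ _ Gk G00; rewrite !addr0.
  rewrite wk => /(congr1 emb); rewrite emb_norm raddf0.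
  by move=> /normr0_eq0/subr0_eq.
have [w w1 wG] := rotation (G v).
rewrite -wG (_ : w * G v = G (w *: v)); last by rewrite linearZ.
by rewrite Gg (le_trans (gp _))// pZ w1 re1 mul1r.
Qed.

End hahn_banach.

(** * Dual norms *)

Section dual_algebra.
Variables (K : numFieldType) (X : normedModType K).
Implicit Types f g : dual X.

Lemma dualP f g : (forall x, f x = g x) -> f = g.
Proof. by move=> fg; apply/val_inj/funext. Qed.

Lemma dualD f g x : (f + g) x = f x + g x :> K. Proof. by []. Qed.

Lemma dual0 x : (0 : dual X) x = 0 :> K. Proof. by []. Qed.

Lemma dualB f g x : (f - g) x = f x - g x :> K. Proof. by []. Qed.

Lemma dualZ a f x : (a *: f) x = a * f x :> K. Proof. by []. Qed.

Lemma dual_sum (I : Type) (r : seq I) (P : pred I) (F : I -> dual X) x :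
  (\sum_(i <- r | P i) F i) x = \sum_(i <- r | P i) (F i x : K) :> K.
Proof. by apply: (big_morph (fun f : dual X => f x : K)). Qed.

Lemma dual_appD f x y : f (x + y) = f x + f y :> K. Proof. exact: linearD. Qed.

Lemma dual_appB f x y : f (x - y) = f x - f y :> K. Proof. exact: linearB. Qed.

Lemma dual_app0 f : f 0 = 0 :> K. Proof. exact: linear0. Qed.

Lemma dual_appZ f a x : f (a *: x) = a * f x :> K. Proof. exact: linearZ. Qed.

Lemma dual_app_sum f (I : Type) (r : seq I) (P : pred I) (F : I -> X) :
  f (\sum_(i <- r | P i) F i) = \sum_(i <- r | P i) (f (F i) : K) :> K.
Proof. exact: linear_sum. Qed.

Lemma dual_of_linear (g : {linear X -> K^o}) (c : K) : 0 <= c ->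
  (forall x, `|g x : K| <= c * `|x|) -> exists f : dual X, forall x, f x = g x.
Proof.
move=> c0 gc; have cg : continuous (g : X -> K^o).
  apply: bounded_linear_continuous; apply/linear_boundedP.
  near=> r => x; rewrite (le_trans (gc x))// ler_wpM2r//.
  by near: r; apply: nbhs_pinfty_ge; exact: ger0_real.
by exists (@Dual K X (g : X -> K^o) (mem_set (conj (linearP g) cg))).
Unshelve. all: by end_near. Qed.

End dual_algebra.

Section dual_norm.
Variables (R : realType) (K : numFieldType) (S : real_structure R K).
Local Notation emb := (emb S).
Local Notation re := (re S).

(** The order of [K] may be only partial, so the supremum is found in the reals, from the real
    parts, and embedded back. *)
Lemma supremums_nonempty (A : set K) (c : K) : A !=set0 ->
  (forall x, A x -> 0 <= x) -> ubound A c -> supremums A !=set0.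
Proof.
move=> [a Aa] A0 Ac; pose B := [set re x | x in A].
have hB : has_sup B.
  split; first by exists (re a), a.
  by exists (re c) => _ [x Ax <-]; apply: le_re; exact: Ac.
exists (emb (sup B)); split=> [x Ax|d Ad].
  rewrite -(re_ge0K S (A0 _ Ax)) emb_le; apply: ub_le_sup; first by case: hB.
  by exists x.
have d0 : 0 <= d by rewrite (le_trans (A0 _ Aa))// Ad.
rewrite -(re_ge0K S d0) emb_le; apply: ge_sup; first by case: hB.
by move=> _ [x Ax <-]; apply: le_re; exact: Ad.
Qed.

Lemma supremumP (A : set K) (c : K) : A !=set0 ->
  (forall x, A x -> 0 <= x) -> ubound A c -> supremums A (supremum 0 A).
Proof.
move=> Ane A0 Ac; have [s As] := supremums_nonempty Ane A0 Ac.
rewrite /supremum ifF; last by apply/negbTE/set0P.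
by case: xgetP => [_ -> //|/(_ s)].
Qed.

Lemma supremum_ub (A : set K) (c x : K) :
  (forall x, A x -> 0 <= x) -> ubound A c -> A x -> x <= supremum 0 A.
Proof.
by move=> A0 Ac Ax; have [|+ _] := supremumP _ A0 Ac; [exists x|exact].
Qed.

Lemma supremum_le (A : set K) (c : K) : A !=set0 ->
  (forall x, A x -> 0 <= x) -> ubound A c -> supremum 0 A <= c.
Proof. by move=> Ane A0 Ac; have [_] := supremumP Ane A0 Ac; exact. Qed.

Variable X : normedModType K.
Implicit Types f g : dual X.

Let ball f : set K := [set `|f x : K| | x in [set x : X | `|x| <= 1]].

Let ball_ge0 f a : ball f a -> 0 <= a.
Proof. by move=> [x _ <-]. Qed.

Let ball_neq0 f : ball f !=set0.
Proof. by exists `|f 0 : K|, 0 => //=; rewrite normr0 ler01. Qed.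

Let ball_bounded f : exists c, ubound (ball f) c.
Proof.
have /(@linear_bounded_continuous K X K^o f)/linear_boundedP :=
  @dual_continuous K X f.
move=> /pinfty_ex_gt0[c c0 fc].
exists c => _ [x /= x1 <-]; rewrite (le_trans (fc x))//.
by rewrite ger_pMr.
Qed.

Lemma dual_norm_ge0 f : 0 <= dual_norm f.
Proof.
have [c fc] := ball_bounded f; have [a fa] := ball_neq0 f.
exact: le_trans (ball_ge0 fa) (supremum_ub (@ball_ge0 f) fc fa).
Qed.

Lemma le_dual_norm f x : `|f x : K| <= dual_norm f * `|x|.
Proof.
have [->|x0] := eqVneq x 0; first by rewrite dual_app0 !normr0 mulr0.
have [c fc] := ball_bounded f; rewrite -ler_pdivrMr ?normr_gt0//.
apply: (supremum_ub (@ball_ge0 f) fc); exists (`|x|^-1 *: x) => /=.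
  by rewrite normrZ normfV normr_id mulVf// normr_eq0.
by rewrite dual_appZ normrM normfV normr_id mulrC.
Qed.

Lemma dual_norm_le f c : 0 <= c -> (forall x, `|f x : K| <= c * `|x|) ->
  dual_norm f <= c.
Proof.
move=> c0 fc; apply: (supremum_le (@ball_neq0 f) (@ball_ge0 f)).
by move=> _ [x /= x1 <-]; rewrite (le_trans (fc x))// ler_piMr.
Qed.

Lemma dual_normZ_le a f : dual_norm (a *: f) <= `|a| * dual_norm f.
Proof.
apply: dual_norm_le => [|x]; first by rewrite mulr_ge0// dual_norm_ge0.
by rewrite dualZ normrM -mulrA ler_wpM2l// le_dual_norm.
Qed.

Lemma dual_normZ a f : dual_norm (a *: f) = `|a| * dual_norm f.
Proof.
have [->|a0] := eqVneq a 0.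
  rewrite normr0 mul0r; apply/eqP; rewrite eq_le dual_norm_ge0 andbT.
  by rewrite (le_trans (dual_normZ_le _ _))// normr0 mul0r.
apply/eqP; rewrite eq_le dual_normZ_le /= -ler_pdivlMl ?normr_gt0//.
rewrite -normfV (le_trans _ (dual_normZ_le _ _))//.
by rewrite scalerA mulVf// scale1r.
Qed.

Lemma dual_normD f g : dual_norm (f + g) <= dual_norm f + dual_norm g.
Proof.
apply: dual_norm_le => [|x]; first by rewrite addr_ge0 ?dual_norm_ge0.
by rewrite dualD mulrDl (le_trans (ler_normD _ _))// lerD ?le_dual_norm.
Qed.

Lemma dual_norm0 : dual_norm (0 : dual X) = 0.
Proof.
apply/eqP; rewrite eq_le dual_norm_ge0 andbT dual_norm_le// => x.
by rewrite dual0 normr0 mul0r.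
Qed.

Lemma dual_norm_sum (I : Type) (r : seq I) (P : pred I) (F : I -> dual X) :
  dual_norm (\sum_(i <- r | P i) F i) <= \sum_(i <- r | P i) dual_norm (F i).
Proof.
apply: (big_ind2 (fun f c => dual_norm f <= c)) => //.
  by rewrite dual_norm0.
by move=> f c g d fc gd; rewrite (le_trans (dual_normD _ _))// lerD.
Qed.

Lemma dual_norm_eq0 f : dual_norm f = 0 -> f = 0.
Proof.
move=> f0; apply: dualP => x; apply/eqP.
by have := le_dual_norm f x; rewrite f0 mul0r normr_le0.
Qed.

Lemma dual_hahn_banach (G0 : X -> K -> Prop) : G0 0 0 ->
  (forall a v k w l, G0 v k -> G0 w l -> G0 (a *: v + w) (a * k + l)) ->
  (forall v k, G0 v k -> `|k| <= `|v|) ->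
  exists f : dual X, (forall v k, G0 v k -> f v = k) /\ dual_norm f <= 1.
Proof.
move=> G00 G0lin G01.
have [|||g [gG0 g1]] := @hahn_banach _ _ S X (fun v => re `|v|) _ _ G0 G00 G0lin.
- by move=> v w; rewrite -raddfD/= le_re// ler_normD.
- by move=> c v; rewrite normrZ re_mulnorm.
- by move=> v k Gvk; rewrite le_re// G01.
have {}g1 x : `|g x : K| <= 1 * `|x|.
  by rewrite mul1r -(emb_norm S) -(emb_normv S x) emb_le.
have [f fg] := dual_of_linear ler01 g1.
exists f; split=> [v k /gG0 <-|]; first exact: fg.
by apply: dual_norm_le => // x; rewrite fg.
Qed.

Lemma norming_functional x : exists f : dual X, dual_norm f <= 1 /\ f x = `|x|.
Proof.
have [||v k [c [-> ->]]|f [fx f1]] :=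
    @dual_hahn_banach (fun v k => exists c, v = c *: x /\ k = c * `|x|).
- by exists 0; rewrite scale0r mul0r.
- move=> a v k w l [c [-> ->]] [d [-> ->]]; exists (a * c + d).
  by rewrite scalerDl scalerA mulrDl mulrA.
- by rewrite normrM normr_id normrZ.
- by exists f; split=> //; apply: fx; exists 1; rewrite scale1r mul1r.
Qed.

Lemma dual_norm_approx f e : 0 < e ->
  exists2 x, `|x| <= 1 & re (dual_norm f) <= re `|f x : K| + e.
Proof.
move=> e0; apply: contrapT => /forall2NP fe.
have {}fe x : `|x| <= 1 -> re `|f x : K| <= re (dual_norm f) - e.
  by move=> x1; have [//|/negP] := fe x; rewrite -ltNge -ltrBrDr => /ltW.
have /fe : `|0 : X| <= 1 by rewrite normr0.
rewrite dual_app0 normr0 raddf0 => c0.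
suff : dual_norm f <= emb (re (dual_norm f) - e).
  rewrite -{1}(re_ge0K S (dual_norm_ge0 f)) emb_le.
  by rewrite lerBrDr gerDl leNgt e0.
apply: dual_norm_le => [|x]; first by rewrite emb_ge0.
have [->|x0] := eqVneq x 0; first by rewrite dual_app0 !normr0 mulr0.
have x1 : `|(`|x|^-1 *: x)| <= 1.
  by rewrite normrZ normfV normr_id mulVf// normr_eq0.
have := fe _ x1; rewrite -(emb_le S) (emb_norm S).
by rewrite dual_appZ normrM normfV normr_id ler_pdivrMl ?normr_gt0// mulrC.
Qed.

Lemma sum_dual_norm_le (I : finType) (h : I -> dual X) (c : R) :
  (forall x : I -> X, (forall i, `|x i| <= 1) -> re `|\sum_i (h i (x i) : K)| <= c) ->
  re (\sum_i dual_norm (h i)) <= c.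
Proof.
move=> hc; apply/ler_addgt0Pr => e e0.
(* Each summand may lose [d]; the successor avoids a division by zero when [I] is empty. *)
pose d := e / #|I|.+1%:R.
have d0 : 0 < d by rewrite divr_gt0// ltr0n.
have /choice[x xP] i : exists x : X, `|x| <= 1 /\
    re (dual_norm (h i)) <= re (h i x : K) + d.
  have [y y1 hy] := dual_norm_approx (h i) d0.
  have [w w1 wh] := rotation (h i y : K).
  by exists (w *: y); rewrite normrZ w1 mul1r dual_appZ wh.
have x1 i : `|x i| <= 1 by case: (xP i).
rewrite raddf_sum/= (le_trans (ler_sum _ (fun i _ => (xP i).2)))//.
rewrite big_split /= -raddf_sum lerD//.
  by rewrite (le_trans (re_le_norm _ _))// hc.
rewrite sumr_const cardT -cardE -mulr_natr /d mulrAC ler_pdivrMr ?ltr0n//.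
by rewrite ler_pM2l// ler_nat leqnSn.
Qed.

(* Hahn-Banach on [X ^ n] with the sublinear function [max_i p_i], applied to
   the functional [f] on the diagonal. *)
Lemma dual_decomposition (n : nat) (p : 'I_n -> X -> R) (f : dual X) :
  (forall i v w, p i (v + w) <= p i v + p i w) ->
  (forall i c v, p i (c *: v) = re `|c| * p i v) ->
  (forall i v, p i v <= re `|v|) ->
  (forall v e, 0 < e -> exists i, re `|f v : K| <= p i v + e) ->
  exists h : 'I_n -> dual X,
    [/\ f = \sum_i h i, \sum_i dual_norm (h i) <= 1 &
      forall i v, p i v = 0 -> h i v = 0].
Proof.
move=> pD pZ p1 fp.
have p0 i : p i 0 = 0 by rewrite -(scale0r 0) pZ normr0 raddf0 mul0r.
have p_ge0 i v : 0 <= p i v.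
  have := pD i v ((-1) *: v).
  by rewrite pZ normrN1 re1 mul1r scaleN1r subrr p0 -mulr2n pmulrn_lge0.
pose P (v : {ffun 'I_n -> X}) := \big[Num.max/0]_i p i (v i).
have P_ub (v : {ffun _}) i : p i (v i) <= P v by exact: le_bigmax.
have PD (v w : {ffun _}) : P (v + w) <= P v + P w.
  apply: bigmax_le => [|i _]; first by rewrite addr_ge0// bigmax_ge_id.
  by rewrite ffunE (le_trans (pD _ _ _))// lerD.
have PZ c (v : {ffun _}) : P (c *: v) = re `|c| * P v.
  rewrite /P (big_morph (fun x => re `|c| * x) (id1 := 0) (op1 := Num.max)).
  - by apply: eq_bigr => i _; rewrite ffunE pZ.
  - by move=> x y; rewrite maxr_pMr// re_norm_ge0.
  - by rewrite mulr0.
pose diag x : {ffun 'I_n -> X} := [ffun=> x].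
have [|||g [gdiag gP]] := hahn_banach PD PZ
    (G0 := fun v k => exists x, v = diag x /\ k = f x).
- by exists 0; rewrite dual_app0; split=> //; apply/ffunP => i; rewrite !ffunE.
- move=> a v k w l [x [-> ->]] [y [-> ->]]; exists (a *: x + y).
  rewrite dual_appD dual_appZ; split=> //.
  by apply/ffunP => i; rewrite !ffunE.
- move=> v k [x [-> ->]]; apply/ler_addgt0Pr => e e0.
  have [i fi] := fp x _ e0; rewrite (le_trans fi)// lerD2r.
  by have := P_ub (diag x) i; rewrite ffunE.
pose dlt i x : {ffun 'I_n -> X} := [ffun j => if j == i then x else 0].
have P_dlt i x : P (dlt i x) <= p i x.
  by apply: bigmax_le => // j _; rewrite ffunE; case: eqP => [->//|_]; rewrite p0.
(* [h i] is the extension [g] composed with the [i]-th injection, so [P_dlt] bounds it by [p i];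
   hence it vanishes wherever [p i] does. *)
have /choice[h hg] i : exists h : dual X, forall x, h x = g (dlt i x).
  have gl : linear (fun x => g (dlt i x) : K^o).
    move=> a x y; rewrite -linearP; congr (g _); apply/ffunP => j.
    by rewrite !ffunE; case: eqP => // _; rewrite scaler0 addr0.
  pose m := GRing.isLinear.Build K X K^o _ (fun x => g (dlt i x) : K^o) gl.
  pose gi := HB.pack_for {linear X -> K^o} (fun x => g (dlt i x) : K^o) m.
  apply: (@dual_of_linear _ _ gi 1) => // x.
  rewrite mul1r -(emb_norm S) -(emb_normv S x) emb_le /=.
  by rewrite (le_trans (gP _))// (le_trans (P_dlt _ _)).
exists h; split=> [||i v piv].
- apply: dualP => x; rewrite dual_sum -(gdiag (diag x) (f x)); last by exists x.
  rewrite (eq_bigr (fun i => g (dlt i x) : K^o)); last by move=> i _; rewrite hg.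
  rewrite -linear_sum; congr (g _); apply/ffunP => j.
  rewrite sum_ffunE ffunE (bigD1 j)//= ffunE eqxx big1 ?addr0// => i ij.
  by rewrite ffunE eq_sym (negbTE ij).
(* Unit-ball vectors [x i], one in each coordinate, form a point where [P] is at most 1. *)
- have : re (\sum_i dual_norm (h i)) <= 1.
    apply: sum_dual_norm_le => x x1.
    rewrite (eq_bigr (fun i => g (dlt i (x i)) : K^o)); last by move=> i _; rewrite hg.
    rewrite -linear_sum (le_trans (gP _))//.
    apply: bigmax_le => // i _; rewrite sum_ffunE (bigD1 i)//= ffunE eqxx.
    rewrite big1 ?addr0; last by move=> j ji; rewrite ffunE eq_sym (negbTE ji).
    by rewrite (le_trans (p1 _ _))// -(re1 S) le_re.
  by rewrite -(emb_le S) rmorph1 re_ge0K// sumr_ge0// => i _; exact: dual_norm_ge0.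
- apply/eqP; rewrite -normr_le0 -(emb_norm S) -(rmorph0 emb) emb_le hg.
  by rewrite (le_trans (gP _))// (le_trans (P_dlt _ _))// piv.
Qed.

End dual_norm.

Section inverse_isometry.
Variables (R : realType) (K : numFieldType) (S : real_structure R K).
Variables (X1 X2 : normedModType K) (J : {linear dual X1 -> dual X2}).
Hypothesis J_isometry : surjective_isometry J.

Lemma isometry_inj : injective J.
Proof.
move=> f g Jfg; apply/subr0_eq/(dual_norm_eq0 S).
by rewrite -J_isometry.1 linearB /= Jfg subrr (dual_norm0 S).
Qed.

Lemma isometry_inverse : exists J' : {linear dual X2 -> dual X1},
  [/\ surjective_isometry J', cancel J J' & cancel J' J].
Proof.
have [Jn /choice[L LK]] := J_isometry.
have JL : cancel J L by move=> f; apply: isometry_inj; rewrite LK.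
have Llin : linear L by move=> a f g; apply: isometry_inj; rewrite LK linearP !LK.
pose m := GRing.isLinear.Build K (dual X2) (dual X1) _ L Llin.
exists (HB.pack_for {linear dual X2 -> dual X1} L m); split=> //.
by split=> [f|f]; [rewrite -Jn /= LK|exists (J f) => /=].
Qed.

End inverse_isometry.

(** * Unconditional systems *)

Section finite_combinations.
Variables (K : numFieldType) (X : normedModType K) (u : nat -> X).
Implicit Types (A B : {fset nat}) (a b : nat -> K).

Definition fincomb A a : X := \sum_(i <- A) a i *: u i.

Lemma eq_fincomb A a b : (forall i, i \in A -> a i = b i) ->
  fincomb A a = fincomb A b.
Proof. by move=> ab; apply: eq_big_seq => i iA; rewrite ab. Qed.

Lemma fincomb_widen A B a : (A `<=` B)%fset ->
  fincomb A a = fincomb B (fun i => if i \in A then a i else 0).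
Proof.
move=> AB; rewrite /fincomb [LHS](eq_big_seq (fun i =>
  (if i \in A then a i else 0) *: u i)); last by move=> i ->.
by apply: big_fset_incl => // i iB /negbTE ->; rewrite scale0r.
Qed.

Lemma fincomb1 i a : fincomb [fset i]%fset a = a i *: u i.
Proof. by rewrite /fincomb big_seq_fset1. Qed.

Lemma fincombP A c a b :
  fincomb A (fun i => c * a i + b i) = c *: fincomb A a + fincomb A b.
Proof.
rewrite /fincomb scaler_sumr -big_split; apply: eq_bigr => i _.
by rewrite scalerDl scalerA.
Qed.

Lemma fincomb0 A : fincomb A (fun=> 0) = 0.
Proof. by rewrite /fincomb big1// => i _; rewrite scale0r. Qed.

Lemma lincombE A (x : c00 K) : (finsupp x `<=` A)%fset ->
  lincomb u x = fincomb A x.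
Proof.
move=> xA; apply: big_fset_incl => // i _ /fsfun_dflt ->.
by rewrite scale0r.
Qed.

Definition c00_of A a : c00 K := [fsfun i in A => a i | 0].

Lemma c00_ofE A a i : c00_of A a i = if i \in A then a i else 0.
Proof. by rewrite fsfunE. Qed.

Lemma finsupp_c00_of A a : (finsupp (c00_of A a) `<=` A)%fset.
Proof.
apply/fsubsetP => i; rewrite mem_finsupp c00_ofE.
by case: ifP => //; rewrite eqxx.
Qed.

Lemma lincomb_c00_of A a : lincomb u (c00_of A a) = fincomb A a.
Proof.
rewrite (lincombE (finsupp_c00_of A a)); apply: eq_fincomb => i iA.
by rewrite c00_ofE iA.
Qed.

(** What the basis of [E] and the canonical vectors of the family spaces have in common. Density of
    finite combinations stands in for the basis expansion, and monotonicity is unconditionality in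
    lattice form. *)
Record unconditional_system : Prop := UnconditionalSystem {
  us_norm : forall i, `|u i| = 1;
  us_mono : forall A a b, (forall i, i \in A -> `|a i| <= `|b i|) ->
    `|fincomb A a| <= `|fincomb A b|;
  us_dense : forall x (c : K), 0 < c ->
    exists A a, `|x - fincomb A a| < c }.

Definition supported_in (A : {fset nat}) (f : dual X) : Prop :=
  forall i, i \notin A -> f (u i) = 0.

End finite_combinations.

Section unconditional_systems.
Variables (R : realType) (K : numFieldType) (S : real_structure R K).
Local Notation emb := (emb S).
Local Notation re := (re S).
Variables (X : normedModType K) (u : nat -> X).
Hypothesis us : unconditional_system u.
Implicit Types (A B F : {fset nat}) (a b : nat -> K) (f g : dual X).

Lemma fincomb_sub A B a : (A `<=` B)%fset -> `|fincomb u A a| <= `|fincomb u B a|.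
Proof.
move=> AB; rewrite (fincomb_widen _ _ AB); apply: (us_mono us) => i _.
by case: ifP => // _; rewrite normr0.
Qed.

Lemma coord_le A a i : i \in A -> `|a i| <= `|fincomb u A a|.
Proof.
move=> iA; have /fincomb_sub : ([fset i] `<=` A)%fset by rewrite fsub1set.
by move=> /(_ a); rewrite fincomb1 normrZ (us_norm us) mulr1.
Qed.

(** [coordf] is a choice with default 0, so a biorthogonal functional must be exhibited: by
    [coord_le] the coefficient at [i] is bounded on finite combinations, and it extends by
    Hahn-Banach. *)
Lemma coordf_eval i j : coordf u i (u j) = (i == j)%:R :> K.
Proof.
rewrite /coordf; case: xgetP => [f _ fP|/(_ _) nof]; first exact: fP.
pose G0 x k := exists A a, [/\ i \in A, x = fincomb u A a & k = a i].
have [|||f [fG _]] := dual_hahn_banach S (G0 := G0).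
- exists [fset i]%fset, (fun=> 0); split=> //; first by rewrite inE.
  by rewrite fincomb0.
- move=> c _ _ _ _ [A [a [iA -> ->]]] [B [b [iB -> ->]]].
  exists (A `|` B)%fset, (fun i => c * (if i \in A then a i else 0) +
    (if i \in B then b i else 0)).
  rewrite fincombP -!fincomb_widen ?fsubsetUl ?fsubsetUr// iA iB.
  by split=> //; rewrite inE iA.
- by move=> _ _ [A [a [iA -> ->]]]; exact: coord_le.
exfalso; apply: (nof f) => k; apply: fG.
(* The set contains [i] as well as [k] because [G0] only reads coefficients over sets containing
   [i]. *)
exists [fset i; k]%fset, (fun l => (l == k)%:R); split=> //.
  by rewrite !inE eqxx.
rewrite /fincomb (big_fsetD1 k) ?inE ?eqxx ?orbT//= scale1r.
rewrite big_seq big1 ?addr0// => l; rewrite !inE => /andP[/negbTE -> _].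
by rewrite scale0r.
Qed.

Lemma dual_fincomb f A a : f (fincomb u A a) = \sum_(i <- A) a i * f (u i) :> K.
Proof. by rewrite dual_app_sum; apply: eq_bigr => i _; rewrite dual_appZ. Qed.

Lemma coordf_fincomb A a i :
  coordf u i (fincomb u A a) = (if i \in A then a i else 0) :> K.
Proof.
rewrite dual_fincomb; case: ifPn => iA.
  rewrite (big_fsetD1 i)//= coordf_eval eqxx mulr1.
  rewrite big_seq big1 ?addr0// => j; rewrite !inE => /andP[ji _].
  by rewrite coordf_eval eq_sym (negbTE ji) mulr0.
rewrite big_seq big1// => j jA; rewrite coordf_eval.
by case: eqP => [ij|_]; [rewrite ij jA in iA|rewrite mulr0].
Qed.

Lemma dual_norm_le_dense f (c : K) : 0 <= c ->
  (forall A a, `|f (fincomb u A a) : K| <= c * `|fincomb u A a|) ->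
  dual_norm f <= c.
Proof.
move=> c0 fc; apply: (dual_norm_le S) => // x.
rewrite -(emb_norm S) -(re_ge0K S (_ : 0 <= c * `|x|)) ?mulr_ge0// emb_le.
apply/ler_addgt0Pr => e e0.
have d0 := dual_norm_ge0 S f.
(* Chosen so that [(c + dual_norm f) * d] is at most [emb e]; the summand 1 keeps the denominator
   positive. *)
pose d : K := emb e / (c + dual_norm f + 1).
have D0 : 0 < c + dual_norm f + 1 by rewrite ltr_wpDl// addr_ge0.
have dgt0 : 0 < d by rewrite divr_gt0// -(rmorph0 emb) emb_lt.
have [A [a xa]] := us_dense us x dgt0.
suff : `|f x : K| <= c * `|x| + emb e.
  rewrite -{1}(emb_norm S) -{1}(re_ge0K S (_ : 0 <= c * `|x|)) ?mulr_ge0//.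
  by rewrite -rmorphD/= emb_le.
have -> : x = fincomb u A a + (x - fincomb u A a) by rewrite addrC subrK.
set y := fincomb u A a; set z := x - y.
rewrite dual_appD (le_trans (ler_normD _ _))//.
have fz : `|f z : K| <= dual_norm f * d.
  by rewrite (le_trans (le_dual_norm S f z))// ler_wpM2l// ltW.
have yz : `|y| <= `|y + z| + d.
  by rewrite -{1}(addrK z y) (le_trans (ler_normB _ _))// lerD2l ltW.
rewrite (le_trans (lerD (fc A a) fz))// -/y.
rewrite (le_trans (lerD (ler_wpM2l c0 yz) (lexx _)))// mulrDr -addrA lerD2l.
rewrite -mulrDl /d mulrC -mulrA ger_pMr ?mulVf//; last first.
  by rewrite -(rmorph0 emb) emb_lt.
by rewrite mulrC ler_pdivrMr// mul1r lerDl.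
Qed.

Lemma dual_ext f g : (forall i, f (u i) = g (u i)) -> f = g.
Proof.
move=> fg; apply/subr0_eq/(dual_norm_eq0 S).
apply/eqP; rewrite eq_le (dual_norm_ge0 S) andbT; apply: dual_norm_le_dense => //.
move=> A a; rewrite dual_fincomb big1 ?normr0 ?mul0r// => i _.
by rewrite dualB fg subrr mulr0.
Qed.

Lemma sum_coordf_eval F a i :
  (\sum_(j <- F) a j *: coordf u j) (u i) = (if i \in F then a i else 0) :> K.
Proof.
rewrite dual_sum (eq_bigr (fun j => a j * (j == i)%:R)); last first.
  by move=> j _; rewrite dualZ coordf_eval.
case: ifPn => iF.
  rewrite (big_fsetD1 i)//= eqxx mulr1.
  rewrite big_seq big1 ?addr0// => j; rewrite !inE => /andP[/negbTE -> _].
  by rewrite mulr0.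
rewrite big_seq big1// => j jF.
by case: eqP => [ij|_]; [rewrite -ij jF in iF|rewrite mulr0].
Qed.

Lemma supported_inE F f : supported_in u F f ->
  f = \sum_(i <- F) (f (u i) : K) *: coordf u i.
Proof.
move=> fF; apply: dual_ext => i; rewrite sum_coordf_eval.
by case: ifPn => // /fF ->.
Qed.

Lemma supported_in_sum F a : supported_in u F (\sum_(i <- F) a i *: coordf u i).
Proof. by move=> i /negbTE iF; rewrite sum_coordf_eval iF. Qed.

Lemma coord_spanP F f : Defs.coord_span u [set` F] f <-> supported_in u F f.
Proof.
split=> [|fF].
  apply; split.
    split=> [i _|c g h gF hF i iF]; first by rewrite dual0.
    by rewrite dualD dualZ gF// hF// mulr0 addr0.
  move=> _ [i /= iF <-] j jF; rewrite coordf_eval.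
  by case: eqP => // ij; rewrite -ij iF in jF.
rewrite (supported_inE fF) => W [[W0 WD] WF].
rewrite big_seq; apply: big_ind => //; last first.
  move=> i iF; rewrite -[X in W X]addr0; apply: WD => //; apply: WF.
  by exists i.
by move=> g h gW hW; rewrite -(scale1r g); exact: WD.
Qed.

(** Cutting a finite combination down to [F] preserves the value of the functional and does not
    increase the norm, so vectors carried by [F] suffice to test the bound. *)
Lemma dual_norm_sum_coordf F a (c : K) : 0 <= c ->
  dual_norm (\sum_(i <- F) a i *: coordf u i) <= c <->
  forall x : nat -> K, `|\sum_(i <- F) a i * x i| <= c * `|fincomb u F x|.
Proof.
move=> c0; set f := \sum_(i <- F) _.
have fE x : f (fincomb u F x) = \sum_(i <- F) a i * x i :> K.
  rewrite dual_fincomb; apply: eq_big_seq => i iF.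
  by rewrite sum_coordf_eval iF mulrC.
split=> [fc x|fc].
  rewrite -fE (le_trans (le_dual_norm S f _))//.
  by rewrite ler_wpM2r.
apply: dual_norm_le_dense => // A x.
have -> : f (fincomb u A x) = f (fincomb u F (fun i => if i \in A then x i else 0)).
  rewrite fE dual_fincomb (eq_bigr (fun i => x i * f (u i)))//.
  transitivity (\sum_(i <- (A `|` F)%fset)
      (if i \in A then x i else 0) * (if i \in F then a i else 0)).
    rewrite (eq_big_seq (fun i =>
      (if i \in A then x i else 0) * (if i \in F then a i else 0))); last first.
      by move=> i iA; rewrite iA sum_coordf_eval.
    by apply: big_fset_incl; rewrite ?fsubsetUl// => i _ /negbTE ->; rewrite mul0r.
  symmetry; rewrite (eq_big_seq (fun i =>
      (if i \in A then x i else 0) * (if i \in F then a i else 0))); last first.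
    by move=> i iF; rewrite iF mulrC.
  by apply: big_fset_incl; rewrite ?fsubsetUr// => i _ /negbTE ->; rewrite mulr0.
rewrite fE (le_trans (fc _))// ler_wpM2l//.
rewrite (fincomb_widen _ x (fsubsetUl A F)) fincomb_sub ?fsubsetUr//.
Qed.

Lemma dual_norm_coordf i : dual_norm (coordf u i) = 1.
Proof.
have -> : coordf u i = \sum_(j <- [fset i]%fset) 1 *: coordf u j.
  by rewrite big_seq_fset1 scale1r.
apply/eqP; rewrite eq_le; apply/andP; split.
  apply/dual_norm_sum_coordf => // x.
  by rewrite big_seq_fset1 !mul1r fincomb1 (normrZ (x i) (u i)) (us_norm us) mulr1.
rewrite big_seq_fset1 scale1r.
have := le_dual_norm S (coordf u i) (u i).
by rewrite coordf_eval eqxx normr1 (us_norm us) mulr1.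
Qed.

End unconditional_systems.

Section transfer.
Variables (R : realType) (K : numFieldType) (S : real_structure R K).
Variables (X Y : normedModType K) (u : nat -> X) (v : nat -> Y).
Hypothesis us : unconditional_system u.
Hypothesis vs : unconditional_system v.

Lemma dual_norm_sum_transfer (F : {fset nat}) (a : nat -> K) :
  (forall x, `|fincomb u F x| = `|fincomb v F x|) ->
  dual_norm (\sum_(i <- F) a i *: coordf u i) =
  dual_norm (\sum_(i <- F) a i *: coordf v i).
Proof.
move=> uv; apply/eqP; rewrite eq_le; apply/andP; split.
  apply/(dual_norm_sum_coordf S us); first exact: (dual_norm_ge0 S) => x.
  move=> x; rewrite uv.
  by move: x; apply/(dual_norm_sum_coordf S vs); first exact: (dual_norm_ge0 S).
apply/(dual_norm_sum_coordf S vs); first exact: (dual_norm_ge0 S) => x.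
move=> x; rewrite -uv.
by move: x; apply/(dual_norm_sum_coordf S us); first exact: (dual_norm_ge0 S).
Qed.

(** Isometric on functionals supported in [F] as soon as the two norms agree on combinations over
    [F]; this is how [J] is compared with maps on the dual of [E]. *)
Definition transfer (F : {fset nat}) (f : dual X) : dual Y :=
  \sum_(i <- F) (f (u i) : K) *: coordf v i.

Lemma supported_transfer F f : supported_in v F (transfer F f).
Proof. exact: (supported_in_sum S vs). Qed.

Lemma transferP F a f g : transfer F (a *: f + g) = a *: transfer F f + transfer F g.
Proof.
rewrite /transfer scaler_sumr -big_split; apply: eq_bigr => i _.
by rewrite dualD dualZ scalerDl scalerA.
Qed.

Lemma transfer_fincomb F f x : transfer F f (fincomb v F x) = f (fincomb u F x) :> K.
Proof.
rewrite !dual_fincomb; apply: eq_big_seq => i iF.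
by rewrite (sum_coordf_eval S vs) iF.
Qed.

Lemma dual_norm_transfer F f : supported_in u F f ->
  (forall x, `|fincomb u F x| = `|fincomb v F x|) ->
  dual_norm (transfer F f) = dual_norm f.
Proof.
move=> fF uv; rewrite [in RHS](supported_inE S us fF).
by apply/esym/dual_norm_sum_transfer.
Qed.

End transfer.

(** * Combinatorial families *)

Section combinatorial_families.
Implicit Types (F : set {fset nat}) (A B : {fset nat}).

Definition initial_part (S : set nat) n : {fset nat} :=
  [fset k in iota 0 n | k \in S]%fset.

Lemma in_initial_part S n k :
  (k \in initial_part S n) = (k < n)%N && (k \in S).
Proof. by rewrite !inE mem_iota add0n. Qed.

Lemma cvg_indicator_initial_part S :
  indicator (initial_part S n) @[n --> \oo] -->
    ((fun k => k \in S) : cantor_space).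
Proof.
apply/cvg_sup => k; apply/cvg_image.
  by rewrite eqEsubset; split => // b _; exists (fun=> b).
move=> B /nbhs_singleton/= Bk; exists [set x : cantor_space | B (x k)].
  exists k.+1 => // n /= kn; rewrite /indicator.
  by rewrite in_initial_part kn.
rewrite eqEsubset; split=> [_ [x Bx <-] //|b Bb].
by exists (fun=> b).
Qed.

(** The indicators of the initial parts converge pointwise to that of [S], and closedness makes the
    limit the indicator of a member; in particular [S] is finite. *)
Lemma compact_family_mem F (S : set nat) : compact_family F ->
  (forall n, F (initial_part S n)) -> exists2 A, F A & forall k, (k \in A) = (k \in S).
Proof.
move=> Fc FS.
have [A FA AS] := closed_cvg _ Fc (nearW _ (fun n => ex_intro2 _ _ _ (FS n) erefl))
  _ (@cvg_indicator_initial_part S).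
by exists A => // k; have := congr1 (fun x => x k) AS.
Qed.

(** Only one-point enlargements are tested; in a hereditary family this amounts to maximality for
    inclusion. *)
Definition maximal_in F A := F A /\ forall k, F (k |` A)%fset -> k \in A.

Lemma maximal_sub F A B : combinatorial_family F -> maximal_in F A -> F B ->
  (A `<=` B)%fset -> A = B.
Proof.
move=> [_ Fsub] [FA Amax] FB AB; apply/eqP; rewrite eqEfsubset AB.
apply/fsubsetP => k kB; apply: Amax; apply: Fsub FB.
by rewrite fsubUset AB fsub1set kB.
Qed.

(* Greedily adding [0], [1], [2], ... whenever the result stays in [F]. *)
Lemma maximal_extension F A : combinatorial_family F -> compact_family F -> F A ->
  exists2 B, maximal_in F B & (A `<=` B)%fset.
Proof.
move=> [F1 Fsub] Fc FA.
pose G := fix G n := if n is m.+1 then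
  (if `[< F (m |` G m)%fset >] then (m |` G m)%fset else G m) else A.
have FG n : F (G n) by elim: n => //= n FGn; case: asboolP.
have GS n : (G n `<=` G n.+1)%fset by rewrite /=; case: ifP; rewrite ?fsubsetU1.
have Gmono m n : (m <= n)%N -> (G m `<=` G n)%fset.
  move=> /subnK <-; elim: (n - m)%N => //= d /fsubset_trans; apply; exact: GS.
pose S := [set k | exists n, k \in G n].
have [|B FB BS] := @compact_family_mem F S Fc.
  (* An initial part of the union is finite, so a single stage contains it and heredity applies. *)
  move=> n; suff [m Sm] : exists m, (initial_part S n `<=` G m)%fset.
    exact: Fsub Sm (FG m).
  elim: n => [|n [m nm]].
    by exists 0%N; apply/fsubsetP => k; rewrite in_initial_part ltn0.
  have [nS|nS] := pselect (S n); last first.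
    exists m; apply/fsubsetP => k; rewrite in_initial_part ltnS leq_eqVlt.
    move=> /andP[/orP[/eqP ->|kn] kS]; first by rewrite inE in kS.
    by apply: (fsubsetP nm); rewrite in_initial_part kn.
  have [m' nm'] := nS; exists (maxn m m'); apply/fsubsetP => k.
  rewrite in_initial_part ltnS leq_eqVlt => /andP[/orP[/eqP ->|kn] kS].
    by apply: fsubsetP nm'; exact/Gmono/leq_maxr.
  apply: (fsubsetP (Gmono _ _ (leq_maxl m m'))); apply: (fsubsetP nm).
  by rewrite in_initial_part kn.
have GB n : (G n `<=` B)%fset.
  by apply/fsubsetP => k kG; rewrite BS inE; exists n.
exists B; last exact: (GB 0%N).
(* At its turn [k] was accepted, since adding it to [G k] gives a subset of the member obtained by
   adding it to [B]. *)
split=> // k FkB; rewrite BS inE; exists k.+1 => /=.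
rewrite asboolT ?fset1U1//; apply: Fsub FkB.
by rewrite fsetUS.
Qed.

Lemma fset0_family F : combinatorial_family F -> F fset0.
Proof. by move=> [F1 Fsub]; apply: Fsub (F1 0%N). Qed.

End combinatorial_families.

(** * The basis of [E] and the canonical vectors of a family space *)

Section basis_system.
Variables (R : realType) (K : numFieldType) (S : real_structure R K).
Variables (E : normedModType K) (e : nat -> E).
Hypothesis e_basis : schauder_basis e.
Hypothesis e_normalized : normalized e.
Hypothesis e_unconditional : one_unconditional e.
Hypothesis e_strict : strictly_one_unconditional e.

Lemma fincomb_strict (A : {fset nat}) (a b : nat -> K) :
  (forall i, i \in A -> `|a i| <= `|b i|) ->
  (exists2 i, i \in A & `|a i| < `|b i|) ->
  `|fincomb e A a| < `|fincomb e A b|.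
Proof.
move=> ab [i iA abi]; rewrite -!lincomb_c00_of; apply: e_strict.
  by move=> j; rewrite !c00_ofE; case: ifP => // jA; exact: ab.
by exists i; rewrite !c00_ofE iA.
Qed.

(** For monotonicity, one strict inequality among the moduli brings in strictness, while equal
    moduli are handled by the signs [a i / b i]. Density comes from the partial sums of the
    expansion. *)
Lemma basis_system : unconditional_system e.
Proof.
split=> [//|A a b ab|x c c0].
  have [[i iA abi]|nab] := pselect (exists2 i, i \in A & `|a i| < `|b i|).
    by apply/ltW/fincomb_strict => //; exists i.
  have {}ab i : i \in A -> `|a i| = `|b i|.
    move=> iA; apply/eqP; apply: contrapT => /negP abi; apply: nab; exists i => //.
    by rewrite lt_neqAle abi ab.
  pose w i := if (i \in A) && (b i != 0) then a i / b i else 1.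
  have w1 i : `|w i| = 1.
    rewrite /w; case: ifP => [/andP[iA bi0]|_]; last by rewrite normr1.
    by rewrite normrM normfV ab// divff// normr_eq0.
  rewrite -(e_unconditional A b w1) le_eqVlt; apply/orP; left; apply/eqP.
  congr `|_|; apply: eq_big_seq => i iA; rewrite /w iA /=.
  case: eqP => [bi0|/eqP bi0] /=; last by rewrite divfK.
  by move: (ab i iA); rewrite bi0 normr0 mulr0 => /normr0_eq0 ->.
have [a [/cvgrPdist_lt /(_ c c0) [n _ an] _]] := e_basis x.
exists (seq_fset tt (iota 0 n)), a; have := an n (leqnn n).
rewrite /fincomb (perm_big _ (seq_fset_perm _ _)) undup_id ?iota_uniq//.
by rewrite /series/= /index_iota subn0.
Qed.

End basis_system.

Section family_space.
Variables (R : realType) (K : numFieldType) (S : real_structure R K).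
Local Notation emb := (emb S).
Local Notation re := (re S).
Variables (E : normedModType K) (e : nat -> E).
Hypothesis es : unconditional_system e.
Variables (F : set {fset nat}) (X : completeNormedModType K) (u : nat -> X).
Hypothesis F_comb : combinatorial_family F.
Hypothesis X_space : is_family_space e F u.
Implicit Types (A G : {fset nat}) (a : nat -> K).

Let restr A a i := if i \in A then a i else 0.

Let bounded A a G : `|fincomb e G (restr A a)| <= `|fincomb e A a|.
Proof.
rewrite (fincomb_widen _ a (fsubsetUr G A)).
exact: (fincomb_sub es _ (fsubsetUl G A)).
Qed.

Let norm_set A a : [set `|\sum_(i <- G) c00_of A a i *: e i| | G in F] =
  [set `|fincomb e G (restr A a)| | G in F].
Proof.
apply: eq_imagel => G _; congr `|_|.
by apply: eq_bigr => i _; rewrite c00_ofE.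
Qed.

Let norm_fincomb A a :
  `|fincomb u A a| = supremum 0 [set `|fincomb e G (restr A a)| | G in F].
Proof. by rewrite -lincomb_c00_of X_space.1 /family_norm norm_set. Qed.

Lemma family_norm_ub A a G : F G ->
  `|fincomb e G (fun i => if i \in A then a i else 0)| <= `|fincomb u A a|.
Proof.
move=> FG; rewrite norm_fincomb; apply: (supremum_ub S (c := `|fincomb e A a|)).
- by move=> _ [H _ <-].
- by move=> _ [H FH <-]; exact: bounded.
- by exists G.
Qed.

Lemma family_norm_le A a (c : K) :
  (forall G, F G -> `|fincomb e G (fun i => if i \in A then a i else 0)| <= c) ->
  `|fincomb u A a| <= c.
Proof.
move=> Fc; rewrite norm_fincomb; apply: (supremum_le S).
- by exists `|fincomb e fset0 (restr A a)|, fset0 => //; exact: fset0_family.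
- by move=> _ [H _ <-].
- by move=> _ [H FH <-]; exact: Fc.
Qed.

(** The supremum is attained at [G] itself, since restricting to another member cannot increase the
    norm in [E]. *)
Lemma family_norm_mem G a : F G -> `|fincomb u G a| = `|fincomb e G a|.
Proof.
move=> FG; apply/eqP; rewrite eq_le; apply/andP; split.
  by apply: family_norm_le => H FH; exact: bounded.
by have := family_norm_ub G a FG; rewrite -fincomb_widen.
Qed.

Lemma family_system : unconditional_system u.
Proof.
split=> [i|A a b ab|x c c0].
- have := family_norm_mem (fun=> 1) (F_comb.1 i).
  by rewrite !fincomb1 !scale1r (us_norm es).
- apply: family_norm_le => G FG; apply: le_trans (family_norm_ub _ _ FG).
  apply: (us_mono es) => i _; case: ifP => // iA; exact: ab.
- have [||y [/= xy [v _ vy]]] := X_space.2 (ball x c).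
  + by exists x; exact: ballxx.
  + exact: ball_open.
  + exists (finsupp v), v; rewrite -lincombE// vy.
    by move: xy; rewrite -ball_normE.
Qed.

End family_space.

(** * Decomposition of functionals over finitely many subsets of the ball *)

Section dual_sup.
Variables (R : realType) (K : numFieldType) (S : real_structure R K).
Local Notation re := (re S).
Variable X : normedModType K.
Implicit Types (C : set (dual X)) (f g : dual X).

Definition dual_sup C (v : X) : R := sup [set re `|g v : K| | g in C].

(** The condition [C 0] makes the supremum defining [dual_sup] run over a nonempty set. *)
Definition in_unit_ball C := C 0 /\ forall g, C g -> dual_norm g <= 1.

Lemma ball_le g v : dual_norm g <= 1 -> re `|g v : K| <= re `|v|.
Proof.
by move=> g1; rewrite le_re// (le_trans (le_dual_norm S g v))// ler_piMl.
Qed.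

Variable C : set (dual X).
Hypothesis C_ball : in_unit_ball C.

Lemma dual_sup_ub g v : C g -> re `|g v : K| <= dual_sup C v.
Proof.
move=> Cg; apply: ub_le_sup; last by exists g.
by exists (re `|v|) => _ [h Ch <-]; apply: ball_le; exact: C_ball.2.
Qed.

Lemma dual_sup_le v c : (forall g, C g -> re `|g v : K| <= c) -> dual_sup C v <= c.
Proof.
move=> Cc; apply: ge_sup; first by exists (re `|(0 : dual X) v : K|), 0 => //; exact: C_ball.1.
by move=> _ [g Cg <-]; exact: Cc.
Qed.

Lemma dual_sup_ge0 v : 0 <= dual_sup C v.
Proof. by apply: le_trans (dual_sup_ub v C_ball.1); exact: re_norm_ge0. Qed.

Lemma dual_sup_norm v : dual_sup C v <= re `|v|.
Proof. by apply: dual_sup_le => g Cg; apply: ball_le; exact: C_ball.2. Qed.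

Lemma dual_supD v w : dual_sup C (v + w) <= dual_sup C v + dual_sup C w.
Proof.
apply: dual_sup_le => g Cg; rewrite dual_appD.
apply: le_trans (le_re S (ler_normD _ _)) _.
by rewrite raddfD lerD// dual_sup_ub.
Qed.

Lemma dual_supZ_le c v : dual_sup C (c *: v) <= re `|c| * dual_sup C v.
Proof.
apply: dual_sup_le => g Cg; rewrite dual_appZ normrM re_mulnorm//.
by rewrite ler_wpM2l ?re_norm_ge0// dual_sup_ub.
Qed.

Lemma dual_supZ c v : dual_sup C (c *: v) = re `|c| * dual_sup C v.
Proof.
have [->|c0] := eqVneq c 0.
  apply/eqP; rewrite eq_le dual_supZ_le normr0 raddf0 mul0r.
  exact: dual_sup_ge0.
apply/eqP; rewrite eq_le dual_supZ_le /=.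
rewrite -[v in X in X <= _](scalerK c0).
rewrite (le_trans (ler_wpM2l (re_norm_ge0 S c) (dual_supZ_le _ _)))//.
rewrite mulrA -re_mulnorm// -normrM divff// normr1 re1 mul1r.
by [].
Qed.

Lemma dual_sup_eq0 v : (forall g, C g -> g v = 0) -> dual_sup C v = 0.
Proof.
move=> Cv; apply/eqP; rewrite eq_le dual_sup_ge0 andbT.
by apply: dual_sup_le => g /Cv ->; rewrite normr0 raddf0.
Qed.

End dual_sup.

Section ball_decomposition.
Variables (R : realType) (K : numFieldType) (S : real_structure R K).
Local Notation re := (re S).
Variable X : normedModType K.

(** The sets [C i] together dominate [f], so [dual_decomposition] applies to their seminorms
    [dual_sup]. Each seminorm vanishes on the common kernel of [C i], hence so does [h i]. *)
Lemma ball_decomposition (n : nat) (C : 'I_n -> set (dual X)) (f : dual X) :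
  (forall i, in_unit_ball (C i)) ->
  (forall v e, 0 < e ->
     exists i, exists2 g, C i g & re `|f v : K| <= re `|g v : K| + e) ->
  exists h : 'I_n -> dual X,
    [/\ f = \sum_i h i, \sum_i dual_norm (h i) <= 1 &
      forall i v, (forall g, C i g -> g v = 0) -> h i v = 0].
Proof.
move=> C1 fC.
have [|||v e e0|h [fh h1 hC]] := @dual_decomposition _ _ S X n (fun i => dual_sup S (C i)) f.
- by move=> i v w; exact: dual_supD.
- by move=> i c v; exact: dual_supZ.
- by move=> i v; exact: dual_sup_norm.
- have [i [g Cg fg]] := fC v e e0.
  by exists i; rewrite (le_trans fg)// lerD2r dual_sup_ub.
by exists h; split=> // i v Cv; apply: hC; exact: dual_sup_eq0.
Qed.

(* If [dual_norm (h i)] is neither 0 nor 1, then [f] is a proper convex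
   combination of normalizations of [h i] and [f - h i]. *)
Lemma extreme_point_sum (W : set (dual X)) (f : dual X) n (h : 'I_n -> dual X) :
  is_subspace W ->
  extreme_points (W `&` [set g | dual_norm g <= 1]) f -> f <> 0 ->
  f = \sum_i h i -> \sum_i dual_norm (h i) <= 1 -> (forall i, W (h i)) ->
  exists i c, f = c *: h i.
Proof.
move=> [W0 WD] [[Wf /= f1] fext] f0 fh h1 Wh.
have [i hi0] : exists i, h i <> 0.
  apply: contrapT => /forallNP h0; apply: f0; rewrite fh big1// => i _.
  exact: contrapT (h0 i).
have WZ c g : W g -> W (c *: g) by move=> Wg; rewrite -[_ *: _]addr0; exact: WD.
pose t := dual_norm (h i).
have t0 : 0 < t.
  rewrite lt_def (dual_norm_ge0 S) andbT; apply/eqP => t0.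
  by apply: hi0; exact: (dual_norm_eq0 S).
have rest : \sum_(j | j != i) dual_norm (h j) <= 1 - t.
  by rewrite lerBrDl; move: h1; rewrite (bigD1 i).
have fhi : f - h i = \sum_(j | j != i) h j.
  by rewrite {1}fh (bigD1 i) // addrAC subrr add0r.
have fhi1 : dual_norm (f - h i) <= 1 - t.
  by rewrite fhi (le_trans (dual_norm_sum S _ _ _)).
have [t1|t1] := eqVneq t 1.
  exists i, 1; rewrite scale1r; apply/subr0_eq/(dual_norm_eq0 S).
  by apply/eqP; rewrite eq_le (dual_norm_ge0 S) andbT (le_trans fhi1)// t1 subrr.
have tlt1 : t < 1.
  rewrite lt_neqAle t1 -subr_ge0 (le_trans _ rest)// sumr_ge0// => j _.
  exact: (dual_norm_ge0 S).
exists i, t^-1.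
have [|||//|->//] := fext (t^-1 *: h i) ((1 - t)^-1 *: (f - h i)) t.
- split; first exact: WZ.
  by rewrite /= (dual_normZ S) gtr0_norm ?invr_gt0// mulVf// gt_eqF.
- split; first by apply: WZ; rewrite addrC -scaleN1r; exact: WD.
  rewrite /= (dual_normZ S) gtr0_norm ?invr_gt0 ?subr_gt0//.
  by rewrite ler_pdivrMl ?subr_gt0// mulr1.
- by rewrite t0.
- by rewrite !scalerA !divff ?scale1r ?gt_eqF ?subr_gt0// addrC subrK.
Qed.

End ball_decomposition.

Section restriction.
Variables (R : realType) (K : numFieldType) (S : real_structure R K).
Local Notation re := (re S).
Variables (X : normedModType K) (u : nat -> X).
Hypothesis us : unconditional_system u.
Implicit Types (A B G : {fset nat}) (a x : nat -> K) (f g : dual X).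

Lemma fincomb_restr A B a :
  `|fincomb u B (fun i => if i \in A then a i else 0)| <= `|fincomb u A a|.
Proof.
rewrite (fincomb_widen _ a (fsubsetUr B A)).
exact: (fincomb_sub us _ (fsubsetUl B A)).
Qed.

Lemma dual_norm_restrict G f :
  dual_norm (\sum_(i <- G) (f (u i) : K) *: coordf u i) <= dual_norm f.
Proof.
apply/(dual_norm_sum_coordf S us); first exact: (dual_norm_ge0 S).
move=> x; rewrite (eq_bigr (fun i => x i * f (u i))); last first.
  by move=> i _; rewrite mulrC.
by rewrite -dual_fincomb; exact: (le_dual_norm S).
Qed.

Lemma supported_fincomb A f : supported_in u A f ->
  forall v, f v = f (fincomb u A (fun i => coordf u i v)) :> K.
Proof.
move=> fA v; rewrite {1}(supported_inE S us fA) dual_sum dual_fincomb.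
by apply: eq_bigr => i _; rewrite dualZ mulrC.
Qed.

End restriction.

Lemma fset_lower_bound (R : realType) (A : {fset nat}) (f : nat -> R) :
  (forall i, i \in A -> 0 < f i) ->
  exists2 d, 0 < d & forall i, i \in A -> d <= f i.
Proof.
move=> f0; exists (\big[Num.min/1]_(i <- A) f i).
  by rewrite big_seq; apply: (big_ind (fun x => 0 < x)) => // x y x0 y0; rewrite lt_min x0.
by move=> i iA; exact: ge_bigmin_seq.
Qed.

(** * Vectors of maximal support and their norming functionals *)

Section maximal_sets.
Variables (R : realType) (K : numFieldType) (S : real_structure R K).
Local Notation emb := (emb S).
Local Notation re := (re S).
Variables (E : normedModType K) (e : nat -> E).
Hypothesis es : unconditional_system e.
Hypothesis e_strict : strictly_one_unconditional e.
Variables (F : set {fset nat}) (X : completeNormedModType K) (u : nat -> X).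
Hypothesis F_comb : combinatorial_family F.
Hypothesis X_space : is_family_space e F u.

(* By strictness [x] has smaller norm on every proper subset of [A], so that
   adding a small multiple of [u k] does not increase the norm of [x]. *)
Lemma norming_supported (A : {fset nat}) (x : nat -> K) (g : dual X) :
  maximal_in F A -> (forall i, i \in A -> x i != 0) -> dual_norm g <= 1 ->
  re `|fincomb u A x| <= re (g (fincomb u A x) : K) -> supported_in u A g.
Proof.
move=> [FA Amax] x0 g1 gx k kA.
have uA := family_norm_mem S es F_comb X_space x FA.
(* [d] bounds from below the loss of norm when one coordinate of [x] is deleted; it is positive by
   strictness. *)
have [d d0 dA] : exists2 d, 0 < d & forall i, i \in A ->
    d <= re `|fincomb e A x| - re `|fincomb e (A `\ i)%fset x|.
  apply: fset_lower_bound => i iA; rewrite subr_gt0 -(emb_lt S) !emb_normv.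
  rewrite (fincomb_widen _ x (fsubD1set A i)); apply: (fincomb_strict e_strict).
    by move=> j _; case: ifP => // _; rewrite normr0.
  by exists i => //; rewrite !inE eqxx normr0 normr_gt0 x0.
have [w w1 wg] := rotation (g (u k) : K).
(* The phase [w] makes the real part of [g] gain [d] times the modulus of [g (u k)]. *)
pose z i := if i == k then emb d * w else x i.
have zE : fincomb u (k |` A)%fset z = (emb d * w) *: u k + fincomb u A x.
  rewrite /fincomb big_fsetU1//= /z eqxx; congr (_ + _).
  by apply: eq_big_seq => i iA; case: eqP => // ik; rewrite -ik iA in kA.
have emb_d0 : 0 <= emb d by rewrite emb_ge0 ltW.
have zle : `|fincomb u (k |` A)%fset z| <= `|fincomb u A x|.
  apply: (family_norm_le S F_comb X_space) => G FG; rewrite uA.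
  have [kG|kG] := boolP (k \in G); last first.
    rewrite (@eq_fincomb _ _ _ _ _ (fun i => if i \in A then x i else 0)).
      exact: fincomb_restr.
    move=> i iG; rewrite !inE /z; case: eqP => // ik.
    by rewrite -ik iG in kG.
  (* A member containing [k] and all of [A] would contradict maximality, so the new coordinate is
     paid for by a missing point [i] of [A]. *)
  have [i iA iG] : exists2 i, i \in A & i \notin G.
    apply: contrapT => /forall2NP AG.
    move: kA; rewrite Amax//; apply: F_comb.2 FG.
    rewrite fsubUset fsub1set kG; apply/fsubsetP => i iA.
    by have [/negP//|/negP/negPn] := AG i.
  rewrite (@eq_fincomb _ _ _ _ _ (fun j => w *
      (if j \in [fset k]%fset then emb d else 0) +
      (if j \in (A `\ i)%fset then x j else 0))); last first.
    move=> j jG; rewrite !inE /z; have [->|jk] := eqVneq j k.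
      by rewrite (negbTE kA) andbF addr0 mulrC.
    rewrite mulr0 add0r /=; case: eqP => [ji|//].
    by rewrite ji (negbTE iG) in jG.
  rewrite (fincombP e G w (fun j => if j \in [fset k]%fset then emb d else 0)).
  apply: le_trans (ler_normD _ _) _; rewrite normrZ w1 mul1r.
  apply: le_trans (lerD (fincomb_restr es _ G (fun=> emb d)) (fincomb_restr es _ G x)) _.
  rewrite fincomb1 normrZ (us_norm es) mulr1 ger0_norm//.
  rewrite -(emb_normv S (fincomb e (A `\ i)%fset x)) -(emb_normv S (fincomb e A x)).
  by rewrite -rmorphD/= emb_le -lerBrDr dA.
have := le_trans (ball_le S (fincomb u (k |` A)%fset z) g1) (le_re S zle).
move=> /(le_trans (re_le_norm _ _)); rewrite zE dual_appD dual_appZ -mulrA wg.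
rewrite raddfD/= re_embM => gk.
have : d * re `|g (u k) : K| <= 0.
  by rewrite -(lerD2r (re `|fincomb u A x|)) add0r (le_trans _ gk)// lerD2l.
rewrite pmulr_rle0// => gk0; apply/eqP; rewrite -normr_le0.
by rewrite -(emb_norm S) -(rmorph0 emb) emb_le.
Qed.

End maximal_sets.

Section family_norming.
Variables (R : realType) (K : numFieldType) (S : real_structure R K).
Local Notation emb := (emb S).
Local Notation re := (re S).
Variables (E : normedModType K) (e : nat -> E).
Hypothesis es : unconditional_system e.
Variables (F : set {fset nat}) (X : completeNormedModType K) (u : nat -> X).
Hypothesis F_comb : combinatorial_family F.
Hypothesis X_space : is_family_space e F u.
Let us := family_system S es F_comb X_space.

Lemma family_norm_approx (B : {fset nat}) (a : nat -> K) (c : R) : 0 < c ->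
  exists2 G, F G & re `|fincomb u B a| <=
    re `|fincomb u G (fun i => if i \in B then a i else 0)| + c.
Proof.
move=> c0; apply: contrapT => /forall2NP nG.
set y := fincomb u B a.
have yG G : F G -> `|fincomb e G (fun i => if i \in B then a i else 0)| <=
    emb (re `|y| - c).
  move=> FG; have [//|/negP] := nG G.
  rewrite -ltNge -ltrBrDr => /ltW; rewrite -(emb_le S) emb_normv.
  by rewrite (family_norm_mem S es F_comb X_space _ FG).
have := family_norm_le S F_comb X_space yG.
by rewrite -/y -{1}(emb_normv S y) emb_le lerBrDr gerDl leNgt c0.
Qed.

(* Every member of the family misses a point of [D], so functionals vanishing
   at some [u j], [j \in D], suffice to compute the norm. *)
Lemma norming_off (D : {fset nat}) (v : X) (c : R) :
  (forall G, F G -> exists2 j, j \in D & j \notin G) -> 0 < c ->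
  exists j h, [/\ j \in D, dual_norm h <= 1, h (u j) = 0 &
    re `|v| <= re `|h v : K| + c].
Proof.
(* Three errors of [c / 3]: from [v] to [y], in the norm of [y], and from [h y] back to [h v]. *)
move=> DF c0; have c3 : 0 < c / 3 by rewrite divr_gt0.
have [|A [a]] := us_dense us v (c := emb (c / 3)).
  by rewrite -(rmorph0 emb) emb_lt.
set y := fincomb u A a => vy.
have {}vy : re `|v - y| <= c / 3.
  by rewrite -(emb_le S) emb_normv ltW.
have [G FG yG] := family_norm_approx A a c3.
have [j jD jG] := DF G FG.
set b := fun i => _ in yG.
have [h0 [h01 h0b]] := norming_functional S (fincomb u G b).
(* Restriction to [G] keeps the norm at most 1 and makes the functional vanish at the point [j]
   outside [G]. *)
pose h := \sum_(i <- G) (h0 (u i) : K) *: coordf u i.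
have h1 : dual_norm h <= 1.
  by rewrite (le_trans (dual_norm_restrict S us _ _)).
have hy : h y = `|fincomb u G b| :> K.
  rewrite -h0b /y !dual_fincomb.
  rewrite (eq_big_seq (fun i => b i * (if i \in G then h0 (u i) else 0))); last first.
    by move=> i iA; rewrite (sum_coordf_eval S us) /b iA.
  rewrite [RHS](eq_big_seq (fun i => b i * (if i \in G then h0 (u i) else 0))); last first.
    by move=> i iG; rewrite iG.
  rewrite (big_fset_incl _ (fsubsetUl A G)); last first.
    by move=> i _ /negbTE iA; rewrite /b iA mul0r.
  rewrite [RHS](big_fset_incl _ (fsubsetUr A G))// => i _ /negbTE ->.
  by rewrite mulr0.
exists j, h; split=> //; first exact: (supported_in_sum S us).
have hvy : re `|h (v - y) : K| <= c / 3.
  exact: le_trans (ball_le S _ h1) vy.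
have := re_norm_dist S v y; have := re_norm_dist S (h y : K) (h v : K).
rewrite (distrC (h y : K)) -dual_appB {1}hy normr_id.
by move: yG hvy vy; rewrite -/y; lra.
Qed.

End family_norming.

(** * Images of maximal sets *)

Section isometries.
Variables (R : realType) (K : numFieldType) (S : real_structure R K).
Local Notation emb := (emb S).
Local Notation re := (re S).
Variables (E : normedModType K) (e : nat -> E).
Hypothesis es : unconditional_system e.
Hypothesis e_strict : strictly_one_unconditional e.
Hypothesis e_extreme : extreme_points_not_covered e.
Variables (F1 F2 : set {fset nat}).
Hypotheses (F1_comb : combinatorial_family F1) (F2_comb : combinatorial_family F2).
Hypothesis F2_compact : compact_family F2.
Variables (X1 X2 : completeNormedModType K) (u1 : nat -> X1) (u2 : nat -> X2).
Hypotheses (X1_space : is_family_space e F1 u1) (X2_space : is_family_space e F2 u2).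
Variable J : {linear dual X1 -> dual X2}.
Hypothesis J_isometry : surjective_isometry J.
Implicit Types (A B G D : {fset nat}).

Let us1 := family_system S es F1_comb X1_space.
Let us2 := family_system S es F2_comb X2_space.

Definition isometry_entry j i : K := J (coordf u1 i) (u2 j).

Lemma isometry_eval A f j : supported_in u1 A f ->
  J f (u2 j) = \sum_(i <- A) f (u1 i) * isometry_entry j i.
Proof.
move=> fA; rewrite {1}(supported_inE S us1 fA) linear_sum dual_sum.
by apply: eq_bigr => i _; rewrite linearZ.
Qed.

Lemma maximal_neq0 A : maximal_in F1 A -> exists i, i \in A.
Proof.
move=> [FA Amax]; have [A0|//] := fset_0Vmem A; last by move=> [i iA]; exists i.
have := Amax 0%N; rewrite {1}A0 fsetU0 => /(_ (F1_comb.1 0%N)) i0.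
by exists 0%N.
Qed.

(* The face of the unit ball of [dual X1] exposed by [x] consists of functionals
   supported in [A], and its image by [J] meets the hyperplane of functionals
   vanishing at [u2 j] for some [j] in [D]. *)
Lemma face_meets_hyperplane A D x : maximal_in F1 A ->
  (forall i, i \in A -> x i != 0) ->
  (forall G, F2 G -> exists2 j, j \in D & j \notin G) ->
  exists j (g : dual E), [/\ j \in D, supported_in e A g, dual_norm g <= 1,
    re `|fincomb e A x| <= re `|g (fincomb e A x) : K| &
    g (fincomb e A (isometry_entry j)) = 0].
Proof.
move=> Amax x0 DF2; have [FA _] := Amax.
set z := fincomb u1 A x.
have z0 : 0 < re `|z|.
  have [i iA] := maximal_neq0 Amax.
  rewrite -(emb_lt S) rmorph0 emb_normv (lt_le_trans _ (coord_le us1 x iA))//.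
  by rewrite normr_gt0 x0.
have [f0 [f01 f0z]] := norming_functional S z.
pose idx (l : 'I_(size D)) := nth 0%N D l.
have idxP j : j \in D -> exists l, idx l = j.
  move=> jD; have jD' : (index j D < size D)%N by rewrite index_mem.
  by exists (Ordinal jD'); rewrite /idx /= nth_index.
pose C l := [set h : dual X2 | dual_norm h <= 1 /\ h (u2 (idx l)) = 0].
have [l|v c c0|h [Jf0 h1 hC]] := @ball_decomposition _ _ S X2 _ C (J f0).
- by split=> [|h []//]; split=> //; rewrite (dual_norm0 S).
- have [j [h [jD h1 hj hv]]] := norming_off S es F2_comb X2_space v DF2 c0.
  have [l lj] := idxP _ jD; exists l, h; first by rewrite /C /= lj.
  apply: le_trans hv; apply: ball_le.
  by rewrite J_isometry.1.
have hidx l : h l (u2 (idx l)) = 0 by apply: hC => g [].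
have /choice[g Jg] l : exists g, J g = h l by exact: J_isometry.2.
have f0g : f0 = \sum_l g l.
  apply: (isometry_inj S J_isometry); rewrite Jf0 linear_sum.
  by apply: eq_bigr => l _; rewrite Jg.
have gn l : dual_norm (g l) = dual_norm (h l) by rewrite -Jg J_isometry.1.
have gz l : re (g l z : K) <= re (dual_norm (h l)) * re `|z|.
  rewrite -re_mulnorm ?(dual_norm_ge0 S)// (le_trans (re_le_norm S _))//.
  by rewrite le_re// -gn (le_dual_norm S).
(* The values at [z] add up to the norm of [z] while the norms add up to at most 1, so every
   inequality [gz] is an equality. *)
have gzE l : re (g l z : K) = re (dual_norm (h l)) * re `|z|.
  apply/eqP; rewrite eq_le gz /= -subr_le0.
  have : \sum_k (re (dual_norm (h k)) * re `|z| - re (g k z : K)) <= 0.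
    rewrite sumrB -mulr_suml -!raddf_sum -dual_sum -f0g f0z subr_le0.
    by rewrite ler_piMl ?re_norm_ge0// -(re1 S) le_re.
  apply: le_trans; rewrite (bigD1 l)//= lerDl sumr_ge0// => k _.
  by rewrite subr_ge0.
have [l hl] : exists l, 0 < dual_norm (h l).
  apply: contrapT => /forallNP h0; move: z0; rewrite -{1}f0z f0g dual_sum.
  rewrite raddf_sum big1 ?ltxx// => l _; rewrite gzE.
  suff -> : dual_norm (h l) = 0 by rewrite (raddf0 re) mul0r.
  apply/eqP; apply: contrapT => hl; apply: (h0 l).
  by rewrite lt_def (dual_norm_ge0 S) andbT; apply/negP.
(* A nonzero piece, normalized, is again norming for [z], hence supported in [A], and its image
   vanishes at [u2 (idx l)]. *)
pose g' := (dual_norm (h l))^-1 *: g l.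
have g'1 : dual_norm g' = 1.
  by rewrite (dual_normZ S) gn gtr0_norm ?invr_gt0// mulVf// gt_eqF.
have g'z : re `|z| <= re (g' z : K).
  have hl0 := ltW hl.
  rewrite dualZ re_mulnorm ?invr_ge0// gzE mulrA -re_mulnorm ?invr_ge0//.
  by rewrite mulVf ?gt_eqF// re1 mul1r.
have g'A : supported_in u1 A g'.
  by apply: (norming_supported (S := S) es e_strict F1_comb X1_space Amax x0); rewrite ?g'1.
exists (idx l), (transfer u1 e A g'); split.
- exact: mem_nth.
- exact: (supported_transfer S _ es).
- rewrite (dual_norm_transfer S us1 es)// ?g'1// => y.
  exact: (family_norm_mem S es F1_comb X1_space).
- rewrite (transfer_fincomb S _ es) -(family_norm_mem S es F1_comb X1_space _ FA) -/z.
  exact: le_trans g'z (re_le_norm S _).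
- rewrite (transfer_fincomb S _ es) dual_fincomb.
  have := isometry_eval (idx l) g'A.
  have -> : J g' = (dual_norm (h l))^-1 *: h l by rewrite linearZ /= Jg.
  rewrite dualZ hidx mulr0 => g'0; rewrite [RHS]g'0.
  by apply: eq_bigr => i _; rewrite mulrC.
Qed.

Lemma vanishing_hyperplane A (x : nat -> K) :
  (exists2 i, i \in A & x i != 0) ->
  hyperplane (Defs.coord_span e [set` A])
    [set g | supported_in e A g /\ g (fincomb e A x) = 0].
Proof.
move=> [i iA xi0]; split.
- split=> [|a g h [gA gx] [hA hx]]; first by split.
  split=> [k kA|]; first by rewrite dualD dualZ gA// hA// mulr0 addr0.
  by rewrite dualD dualZ gx hx mulr0 addr0.
- by move=> g [gA _]; apply/(coord_spanP S es).
- have iE : coordf e i (fincomb e A x) = x i :> K.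
    by rewrite (coordf_fincomb S es) iA.
  have iS : supported_in e A (coordf e i).
    move=> j jA; rewrite (coordf_eval S es); case: eqP => // ij.
    by rewrite -ij iA in jA.
  exists (coordf e i); split.
  + exact/(coord_spanP S es).
  + by move=> [_]; rewrite iE; apply/eqP.
  + move=> g /(coord_spanP S es) gA; exists (g (fincomb e A x) / x i).
    split=> [j jA|]; first by rewrite dualB dualZ gA// iS// mulr0 subr0.
    by rewrite dualB dualZ iE divfK// subrr.
Qed.

(* Otherwise a finite subset [D] of the union of the supports of the
   [J (coordf u1 i)] is not in [F2], the norm of [E] on the span of [A] is computed
   by functionals lying in the hyperplanes indexed by [D], and then so are the
   extreme points of the dual ball. *)
Lemma isometry_supported A : maximal_in F1 A ->
  exists2 B, F2 B & forall f, supported_in u1 A f -> supported_in u2 B (J f).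
Proof.
move=> Amax; have [FA _] := Amax.
pose T := [set j | exists2 i, i \in A & isometry_entry j i != 0].
have [FT|nFT] := pselect (forall n, F2 (initial_part T n)).
  have [B FB BT] := compact_family_mem F2_compact FT.
  exists B => // f fA j jB; rewrite (isometry_eval j fA) big_seq big1// => i iA.
  apply/eqP; rewrite mulf_eq0; apply/orP; right; apply: contrapT => /negP ji.
  by move: jB; rewrite BT => /negP; apply; rewrite inE; exists i.
exfalso; move/existsNP: nFT => [n nFD]; set D := initial_part T n in nFD.
have DF2 G : F2 G -> exists2 j, j \in D & j \notin G.
  move=> FG; apply: contrapT => /forall2NP DG; apply: nFD.
  apply: F2_comb.2 FG; apply/fsubsetP => j jD.
  by have [/negP//|/negP/negPn] := DG j.
have DT j : j \in D -> exists2 i, i \in A & isometry_entry j i != 0.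
  by rewrite in_initial_part => /andP[_]; rewrite inE.
pose idx (l : 'I_(size D)) := nth 0%N D l.
have idxD l : idx l \in D by exact: mem_nth.
have idxP j : j \in D -> exists l, idx l = j.
  move=> jD; have jD' : (index j D < size D)%N by rewrite index_mem.
  by exists (Ordinal jD'); rewrite /idx /= nth_index.
pose H l := [set g | supported_in e A g /\ g (fincomb e A (isometry_entry (idx l))) = 0].
have := @e_extreme A _ H (fun l => vanishing_hyperplane (DT _ (idxD l))).
apply => f fext; apply: contrapT => nH.
have [[/= /(coord_spanP S es) fA f1] _] := fext.
pose C l := [set g : dual E | H l g /\ dual_norm g <= 1].
have C1 l : in_unit_ball (C l).
  by split=> [|h []//]; split=> //; rewrite (dual_norm0 S).
have fC v c : 0 < c ->
    exists l, exists2 g, C l g & re `|f v : K| <= re `|g v : K| + c.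
  move=> c0.
  pose x i : K := coordf e i v.
  pose d : R := c / 2 / (size A).+1%:R.
  have d0 : 0 < d by rewrite !divr_gt0// ltr0n.
  have ed0 : 0 <= emb d by rewrite emb_ge0 ltW.
  (* Zero coordinates are raised to [d], because [face_meets_hyperplane] needs all coordinates over
     [A] nonzero. The size of [d] keeps the total change at most [c / 2], and this change is counted
     twice. *)
  pose x' i := if x i == 0 then emb d else x i.
  have x'0 i : i \in A -> x' i != 0.
    by rewrite /x'; case: (eqVneq (x i) 0) => //; rewrite fmorph_eq0 gt_eqF.
  have [j [g [jD gA g1 gx gj]]] := face_meets_hyperplane Amax x'0 DF2.
  have [l lj] := idxP _ jD; exists l, g; first by rewrite /C /H /= lj.
  have close : re `|fincomb e A x - fincomb e A x'| <= c / 2.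
    rewrite /fincomb -sumrB.
    have : `|\sum_(i <- A) (x i *: e i - x' i *: e i)| <= \sum_(i <- A) emb d.
      apply: le_trans (ler_norm_sum _ _ _) _; apply: ler_sum => i _.
      rewrite -scalerBl normrZ (us_norm es) mulr1 /x'.
      case: eqP => [->|_]; last by rewrite subrr normr0.
      by rewrite sub0r normrN ger0_norm.
    rewrite -(emb_le S) emb_normv => /le_trans; apply.
    rewrite -(raddf_sum emb) emb_le.
    have c20 : 0 <= c / 2 by rewrite divr_ge0// ltW.
    rewrite big_const_seq count_predT iter_addr_0 -[_ *+ _]mulr_natr /d -(mulrA (c / 2)).
    by rewrite ler_piMr// mulrC ler_pdivrMr ?ltr0n// mul1r ler_nat.
  have fx : re `|f v : K| <= re `|fincomb e A x|.
    by rewrite (supported_fincomb S es fA); exact: ball_le.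
  rewrite (supported_fincomb S es gA v).
  have t1 := re_norm_dist S (fincomb e A x) (fincomb e A x').
  have t2 := re_norm_dist S (g (fincomb e A x') : K) (g (fincomb e A x) : K).
  have t3 := ball_le S (fincomb e A x' - fincomb e A x) g1.
  rewrite dual_appB in t3; rewrite distrC in close.
  rewrite (distrC (fincomb e A x)) in t1.
  by move: close fx t1 t2 t3 gx; rewrite -/x; lra.
have [h [fh h1 hC]] := ball_decomposition C1 fC.
have hA l : supported_in e A (h l).
  by move=> i iA; apply: hC => g [[gA _] _]; exact: gA.
have hy l : h l (fincomb e A (isometry_entry (idx l))) = 0.
  by apply: hC => g [[_ gy] _]; exact: gy.
(* Zero lies in every [H l]; [fC 0 1] is called only to produce an index [l]. *)
have f0 : f <> 0.
  move=> f0; have [l _] := fC 0 1 ltr01; apply: nH; exists l => //.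
  by rewrite f0; split.
have [||l [c fhl]] := extreme_point_sum S _ fext f0 fh h1.
- split; first by apply/(coord_spanP S es).
  move=> c g k /(coord_spanP S es) gA /(coord_spanP S es) kA.
  apply/(coord_spanP S es) => i iA.
  by rewrite dualD dualZ gA// kA// mulr0 addr0.
- by move=> l; apply/(coord_spanP S es).
by apply: nH; exists l => //; split=> //; rewrite fhl dualZ hy mulr0.
Qed.

End isometries.

(** * Mutually inverse isometries and the real case *)

Section isometry_pairs.
Variables (R : realType) (K : numFieldType) (S : real_structure R K).
Variables (E : normedModType K) (e : nat -> E).
Hypothesis es : unconditional_system e.
Hypothesis e_strict : strictly_one_unconditional e.
Hypothesis e_extreme : extreme_points_not_covered e.
Variables (F1 F2 : set {fset nat}).
Hypotheses (F1_comb : combinatorial_family F1) (F2_comb : combinatorial_family F2).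
Hypotheses (F1_compact : compact_family F1) (F2_compact : compact_family F2).
Variables (X1 X2 : completeNormedModType K) (u1 : nat -> X1) (u2 : nat -> X2).
Hypotheses (X1_space : is_family_space e F1 u1) (X2_space : is_family_space e F2 u2).
Variables (J : {linear dual X1 -> dual X2}) (J' : {linear dual X2 -> dual X1}).
Hypotheses (J_isometry : surjective_isometry J) (J'_isometry : surjective_isometry J').
Hypotheses (JK : cancel J J') (J'K : cancel J' J).
Implicit Types (A B : {fset nat}).

Let us1 := family_system S es F1_comb X1_space.
Let us2 := family_system S es F2_comb X2_space.

Lemma coordf_supported (X : normedModType K) (u : nat -> X) A i :
  unconditional_system u -> i \in A -> supported_in u A (coordf u i).
Proof.
move=> us iA j jA; rewrite (coordf_eval S us); case: eqP => // ij.
by rewrite -ij iA in jA.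
Qed.

(** The member carrying the image of [A] is enlarged to a maximal [B], whose image under [J'] is
    carried by a member [A']. As [J'] undoes [J], [A'] contains [A], and maximality gives
    equality. *)
Lemma isometry_maximal A : maximal_in F1 A -> exists B, [/\ maximal_in F2 B,
  forall f, supported_in u1 A f -> supported_in u2 B (J f) &
  forall f, supported_in u2 B f -> supported_in u1 A (J' f)].
Proof.
move=> Amax.
have [B0 FB0 JB0] := isometry_supported S es e_strict e_extreme F1_comb F2_comb
  F2_compact X1_space X2_space J_isometry Amax.
have [B Bmax B0B] := maximal_extension F2_comb F2_compact FB0.
have JB f : supported_in u1 A f -> supported_in u2 B (J f).
  move=> fA j jB; apply: JB0 => //; apply: contra jB; exact: fsubsetP.
have [A' FA' JA'] := isometry_supported S es e_strict e_extreme F2_comb F1_comb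
  F1_compact X2_space X1_space J'_isometry Bmax.
suff AA' : A = A' by exists B; split=> //; rewrite AA'.
apply: (maximal_sub F1_comb Amax FA'); apply/fsubsetP => i iA.
apply: contrapT => /negP iA'.
have := JA' _ (JB _ (coordf_supported us1 iA)) _ iA'.
by rewrite JK (coordf_eval S us1) eqxx => /eqP; rewrite oner_eq0.
Qed.

(** Transferred to the dual of [E] through [A] and [B], [J] becomes an isometric embedding on the
    span of two coordinate functionals, to which the hypothesis on [E] applies. *)
Lemma real_disjoint A i k l : embeddings_disjoint_supports e ->
  maximal_in F1 A -> i \in A -> k \in A -> i <> k ->
  J (coordf u1 i) (u2 l) <> 0 -> J (coordf u1 k) (u2 l) = 0.
Proof.
move=> e_disj Amax iA kA ik Jil; have [FA _] := Amax.
have [B [[FB _] JB _]] := isometry_maximal Amax.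
have lB : l \in B.
  apply: contrapT => /negP lB; apply: Jil.
  exact: (JB _ (coordf_supported us1 iA)).
pose T f := transfer u2 e B (J (transfer e u1 A f)).
have fromA j : j \in A -> transfer e u1 A (coordf e j) = coordf u1 j.
  move=> jA; rewrite [RHS](supported_inE S us1 (coordf_supported us1 jA)).
  apply: eq_bigr => m _; congr (_ *: _).
  by rewrite (coordf_eval S es) (coordf_eval S us1).
have Teval j : j \in A -> T (coordf e j) (e l) = J (coordf u1 j) (u2 l).
  by move=> jA; rewrite /T fromA// (sum_coordf_eval S es) lB.
have spanE f : Defs.coord_span e [set i; k] f -> supported_in e A f.
  have -> : [set i; k] = [set` [fset i; k]%fset].
    apply/seteqP; split=> j /=; rewrite !inE; first by case=> ->; rewrite eqxx ?orbT.
    by move=> /orP[] /eqP ->; [left|right].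
  move=> /(coord_spanP S es) fik j jA; apply: fik.
  by rewrite !inE negb_or; apply/andP; split; apply: contraNneq jA => ->.
have disj : Defs.support e (T (coordf e i)) `&` Defs.support e (T (coordf e k)) = set0.
  apply: (e_disj i k ik T).
  - by move=> a f g _ _; rewrite /T !(transferP, linearP).
  - move=> f /spanE fA.
    rewrite /T (dual_norm_transfer S us2 es); last 2 first.
    + by apply: JB; exact: (supported_transfer S _ us1).
    + by move=> x; exact: (family_norm_mem S es F2_comb X2_space).
    rewrite J_isometry.1 (dual_norm_transfer S es us1)// => x.
    by rewrite (family_norm_mem S es F1_comb X1_space).
apply: contrapT => Jkl.
suff : (set0 : set nat) l by [].
by rewrite -disj; split; rewrite /Defs.support /= Teval//; apply/eqP.
Qed.

Definition singly_supported (f : dual X2) := forall l m, l <> m ->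
  f (u2 l) <> 0 -> f (u2 m) = 0.

(** On the support of [J (coordf u1 i)] the images of the other functionals indexed by [A] vanish,
    so there [coordf u2 l], written as the image of its preimage, is a fixed multiple of
    [J (coordf u1 i)]. Evaluation at [l] shows the multiple to be nonzero; evaluation at [m] then
    gives a contradiction. *)
Lemma real_singly_supported A i : embeddings_disjoint_supports e ->
  maximal_in F1 A -> i \in A -> singly_supported (J (coordf u1 i)).
Proof.
move=> e_disj Amax iA l m lm Jil; apply: contrapT => Jim.
have [B [_ JB J'A]] := isometry_maximal Amax.
have lB : l \in B.
  apply: contrapT => /negP lB; apply: Jil.
  exact: (JB _ (coordf_supported us1 iA)).
have J'lA := J'A _ (coordf_supported us2 lB).
have eval j : J (coordf u1 i) (u2 j) <> 0 ->
    coordf u2 l (u2 j) = J' (coordf u2 l) (u1 i) * J (coordf u1 i) (u2 j) :> K.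
  move=> Jij; rewrite -[coordf u2 l in LHS]J'K (isometry_eval S es F1_comb u2 X1_space J _ J'lA).
  rewrite (big_fsetD1 i)//= big_seq big1 ?addr0// => k; rewrite !inE => /andP[ki kA].
  rewrite /isometry_entry (real_disjoint (i := i) e_disj Amax iA kA _ Jij) ?mulr0//.
  by move=> ik; rewrite ik eqxx in ki.
have := eval _ Jim; have := eval _ Jil.
rewrite !(coordf_eval S us2) eqxx => c1 /esym/eqP.
have /eqP/negbTE -> := lm; rewrite mulf_eq0 => /orP[/eqP c0|/eqP //].
by move: c1; rewrite c0 mul0r => /eqP; rewrite oner_eq0.
Qed.

Lemma monomial_image A : (forall i, i \in A -> singly_supported (J (coordf u1 i))) ->
  maximal_in F1 A -> exists2 B, F2 B & forall i, i \in A ->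
    exists k w, [/\ k \in B, `|w| = 1 & J (coordf u1 i) = w *: coordf u2 k].
Proof.
move=> A1 Amax; have [B [[FB _] JB _]] := isometry_maximal Amax.
exists B => // i iA.
have [k Jk] : exists k, J (coordf u1 i) (u2 k) <> 0.
  apply: contrapT => /forallNP J0.
  have Ji0 : J (coordf u1 i) = 0.
    by apply: (dual_ext S us2) => k; rewrite dual0; exact: contrapT (J0 k).
  have := dual_norm_coordf S us1 i; rewrite -J_isometry.1 Ji0 (dual_norm0 S).
  by move=> /esym/eqP; rewrite oner_eq0.
have Jik : J (coordf u1 i) = (J (coordf u1 i) (u2 k) : K) *: coordf u2 k.
  apply: (dual_ext S us2) => m; rewrite dualZ (coordf_eval S us2).
  by case: eqP => [->|/(A1 _ iA k m)->//]; rewrite ?mulr1 ?mulr0.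
exists k, (J (coordf u1 i) (u2 k)); split=> //.
  apply: contrapT => /negP kB; apply: Jk.
  exact: (JB _ (coordf_supported us1 iA)).
have := congr1 (@dual_norm _ _) Jik.
rewrite (dual_normZ S) (dual_norm_coordf S us2) mulr1 J_isometry.1.
by rewrite (dual_norm_coordf S us1).
Qed.

End isometry_pairs.

(** * From monomial images to a signed permutation *)

Section assembly.
Variables (R : realType) (K : numFieldType) (S : real_structure R K).
Variables (X1 X2 : normedModType K) (u1 : nat -> X1) (u2 : nat -> X2).
Hypotheses (us1 : unconditional_system u1) (us2 : unconditional_system u2).
Variables (F1 F2 : set {fset nat}).
Hypotheses (F1_comb : combinatorial_family F1) (F2_comb : combinatorial_family F2).
Hypotheses (F1_compact : compact_family F1) (F2_compact : compact_family F2).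
Variables (J : {linear dual X1 -> dual X2}) (J' : {linear dual X2 -> dual X1}).
Hypotheses (JK : cancel J J') (J'K : cancel J' J).

Lemma monomial_inj (X : normedModType K) (u : nat -> X) (v w : K) i j :
  unconditional_system u -> v != 0 -> v *: coordf u i = w *: coordf u j -> i = j.
Proof.
move=> us v0 /(congr1 (fun f : dual X => f (u i) : K)).
rewrite !dualZ !(coordf_eval S us) eqxx mulr1.
by case: eqP => [->//|_]; rewrite mulr0 => /eqP; rewrite (negbTE v0).
Qed.

(** Every member lies in a maximal one, so the index map of [J] sends [F1] into [F2], and that of
    [J'] sends [F2] into [F1]. These index maps are mutually inverse because [J] and [J'] are, so
    the first carries [F1] onto [F2]. *)
Lemma monomial_compatible :
  (forall A, maximal_in F1 A -> exists2 B, F2 B & forall i, i \in A ->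
    exists k w, [/\ k \in B, `|w| = 1 & J (coordf u1 i) = w *: coordf u2 k]) ->
  (forall B, maximal_in F2 B -> exists2 A, F1 A & forall i, i \in B ->
    exists k w, [/\ k \in A, `|w| = 1 & J' (coordf u2 i) = w *: coordf u1 k]) ->
  compatible_signed_permutation F1 F2 u1 u2 J.
Proof.
move=> H H'.
have pick (X Y : normedModType K) (u : nat -> X) (v : nat -> Y) (F G : set {fset nat})
    (L : dual X -> dual Y) :
    unconditional_system v -> combinatorial_family F -> compact_family F ->
    combinatorial_family G ->
    (forall A, maximal_in F A -> exists2 B, G B & forall i, i \in A ->
      exists k w, [/\ k \in B, `|w| = 1 & L (coordf u i) = w *: coordf v k]) ->
    exists pw : nat -> nat * K, (forall i, `|(pw i).2| = 1 /\
      L (coordf u i) = (pw i).2 *: coordf v (pw i).1) /\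
      forall A, F A -> G [fset (pw i).1 | i in A]%fset.
  move=> vs Fc Fk Gc L1.
  have /choice[pw pwP] i : exists kw : nat * K, `|kw.2| = 1 /\
      L (coordf u i) = kw.2 *: coordf v kw.1.
    have [A Amax iA] := maximal_extension Fc Fk (Fc.1 i).
    have [B _ /(_ i)] := L1 A Amax; case; first by rewrite -fsub1set.
    by move=> k [w [_ w1 Lk]]; exists (k, w).
  exists pw; split=> // A0 FA0.
  have [A Amax A0A] := maximal_extension Fc Fk FA0.
  have [B GB BP] := L1 A Amax; apply: Gc.2 GB; apply/fsubsetP => k.
  move=> /imfsetP[i /= iA0 ->].
  (* The index found through this maximal set is the one already chosen, since a nonzero multiple of
     a coordinate functional determines its index. *)
  have [k' [w [k'B _]]] := BP i (fsubsetP A0A _ iA0).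
  have [n1 ->] := pwP i => /monomial_inj ->//.
  by rewrite -normr_eq0 n1 oner_eq0.
have [pw [pwP pwF]] := pick _ _ _ _ _ _ J us2 F1_comb F1_compact F2_comb H.
have [pw' [pwP' pwF']] := pick _ _ _ _ _ _ J' us1 F2_comb F2_compact F1_comb H'.
have nz i : (pw i).2 != 0 by rewrite -normr_eq0 (pwP i).1 oner_eq0.
have nz' i : (pw' i).2 != 0 by rewrite -normr_eq0 (pwP' i).1 oner_eq0.
have pK i : (pw' (pw i).1).1 = i.
  have := JK (coordf u1 i); rewrite (pwP i).2 linearZ /= (pwP' _).2 scalerA.
  by rewrite -[RHS]scale1r => /monomial_inj ->//; rewrite mulf_neq0.
have p'K i : (pw (pw' i).1).1 = i.
  have := J'K (coordf u2 i); rewrite (pwP' i).2 linearZ /= (pwP _).2 scalerA.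
  by rewrite -[RHS]scale1r => /monomial_inj ->//; rewrite mulf_neq0.
exists (fun i => (pw i).2), (fun i => (pw i).1); split.
- by move=> i; exact: (pwP i).1.
- by exists (fun i => (pw' i).1).
- apply/seteqP; split=> [_ [A FA <-]|B FB]; first exact: pwF.
  exists [fset (pw' i).1 | i in B]%fset; first exact: pwF'.
  apply/fsetP => k; apply/imfsetP/idP => /= [[i /imfsetP[j /= jB ->] ->]|kB].
    by rewrite p'K.
  exists (pw' k).1; last by rewrite p'K.
  by apply/imfsetP; exists k.
- by move=> i; exact: (pwP i).2.
Qed.

End assembly.

(** * The complex case *)

Section planar_norms.
Variable R : realType.

(* Telescoping along a subdivision into [n] steps bounds the increment by [O(1/n)]. *)
Lemma quadratic_increments_const (f : R -> R) (T C x y : R) :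
  (forall s t, 0 < s <= T -> 0 < t <= T -> f s - f t <= C * (s - t) ^+ 2) ->
  0 < x <= T -> 0 < y <= T -> f x = f y.
Proof.
move=> fC.
have le s t : 0 < s <= T -> 0 < t <= T -> f s <= f t.
  move=> sT tT; apply/ler_addgt0Pr => e e0.
  have C0 : 0 <= `|C| * (s - t) ^+ 2 by rewrite mulr_ge0// sqr_ge0.
  (* With [n] steps the total increment is at most the modulus of [C] times [(s - t) ^+ 2 / n],
     hence below [e]. *)
  pose n := (Num.trunc (`|C| * (s - t) ^+ 2 / e)).+1.
  have nb : `|C| * (s - t) ^+ 2 < e * n%:R.
    by rewrite [ltRHS]mulrC -ltr_pdivrMr//; exact: truncnS_gt.
  have n0 : 0 < n%:R :> R by rewrite ltr0n.
  pose d := (s - t) / n%:R.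
  have nd : n%:R * d = s - t by rewrite mulrC divfK// gt_eqF.
  have step k : (k <= n)%N -> 0 < t + k%:R * d <= T.
    move=> kn; set a : R := k%:R / n%:R.
    have a01 : 0 <= a <= 1.
      by rewrite divr_ge0 ?ler0n//= ler_pdivrMr// mul1r ler_nat.
    have -> : t + k%:R * d = (1 - a) * t + a * s by rewrite /d /a; ring.
    by move: sT tT a01; nra.
  have tele k : (k <= n)%N -> f (t + k%:R * d) <= f t + k%:R * (`|C| * d ^+ 2).
    elim: k => [|k IH] kn; first by rewrite !mul0r !addr0.
    have := fC _ _ (step _ kn) (step _ (ltnW kn)).
    have := IH (ltnW kn).
    have -> : t + k.+1%:R * d - (t + k%:R * d) = d by rewrite -natr1; ring.
    have : C * d ^+ 2 <= `|C| * d ^+ 2 by rewrite ler_wpM2r ?sqr_ge0 ?ler_norm.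
    by rewrite -natr1; lra.
  have := tele n (leqnn n); rewrite nd addrC subrK => /le_trans; apply.
  rewrite lerD2l -(ler_pM2l n0).
  have -> : n%:R * (n%:R * (`|C| * d ^+ 2)) = `|C| * (n%:R * d) ^+ 2 by ring.
  by rewrite nd [leRHS]mulrC ltW.
by move=> xT yT; apply/eqP; rewrite eq_le !le.
Qed.

Variables (N : R -> R -> R) (al be : R).
Hypothesis N_homo : forall c x y, 0 <= c -> 0 <= x -> 0 <= y ->
  N (c * x) (c * y) = c * N x y.
Hypothesis N_bound : forall x y, 0 <= x -> 0 <= y ->
  [/\ x <= N x y, y <= N x y & N x y <= x + y].
Hypotheses (al_ge0 : 0 <= al) (be_gt0 : 0 < be).
Hypothesis N_support : forall s t, 0 < s -> 0 < t -> exists P Q,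
  [/\ 0 <= P, 0 <= Q, N s t <= P * s + Q * t,
    forall x y, 0 <= x -> 0 <= y -> P * x + Q * y <= N x y &
    P * t * al = Q * s * be].

Let r := al / be.

(** If [al] vanished, the functional supporting [N] at [(1, 2)] would have [Q = 0], hence [P >= 2],
    against [P <= N 1 0 <= 1]. *)
Let r_gt0 : 0 < r.
Proof.
rewrite divr_gt0// lt_def al_ge0 andbT; apply/eqP => al0.
have [P [Q [P0 Q0 N12 NPQ]]] := N_support ltr01 (ltr0n R 2 : 0 < 2).
rewrite al0 mulr0 mulr1 => /esym/eqP; rewrite mulf_eq0 (gt_eqF be_gt0) orbF => /eqP Qe.
have [_ N2 _] := N_bound ler01 (ler0n R 2).
have [_ _ N1] := N_bound ler01 (lexx 0).
have := NPQ 1 0 ler01 (lexx 0).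
by move: N12; rewrite Qe; lra.
Qed.

Let n t := N 1 t.

(** The functional supporting [N] at [(1, t)] is proportional to [(1, r * t)]; comparing its values
    at [(1, t)] and [(1, s)] eliminates [P]. *)
Let n_support s t : 0 < s -> 0 < t ->
  n t * (1 + r * t * s) <= n s * (1 + r * t ^+ 2).
Proof.
move=> s0 t0; have [P [Q [P0 Q0 Nt NPQ PQ]]] := N_support ltr01 t0.
have Qe : Q = r * P * t.
  apply: (mulIf (_ : be != 0)); first by rewrite gt_eqF.
  rewrite -[LHS]mulr1; move: PQ; rewrite !mulr1 /r => <-.
  by field; rewrite gt_eqF.
have Ns := NPQ 1 s ler01 (ltW s0).
have -> : n t = P * (1 + r * t ^+ 2).
  apply/eqP; rewrite eq_le; apply/andP; split.
    by move: Nt; rewrite Qe /n; lra.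
  by have := NPQ 1 t ler01 (ltW t0); rewrite Qe /n; lra.
have D0 : 0 <= 1 + r * t ^+ 2.
  by rewrite addr_ge0// mulr_ge0 ?sqr_ge0// ltW.
rewrite mulrAC ler_wpM2r//.
by move: Ns; rewrite Qe /n; lra.
Qed.

Let D t := 1 + r * t ^+ 2.

Let D_ge1 t : 1 <= D t.
Proof. by rewrite lerDl mulr_ge0 ?sqr_ge0// ltW. Qed.

Let D_gt0 t : 0 < D t.
Proof. exact: lt_le_trans ltr01 (D_ge1 t). Qed.

Let M t := n t ^+ 2 / D t.

(** Squaring [n_support] and writing [(1 + r * t * s) ^+ 2] as [D t * D s - r * (t - s) ^+ 2] leaves
    an error quadratic in [t - s], whose coefficient is controlled by [M t <= (1 + T) ^+ 2]. *)
Let M_increments (T s t : R) : 0 < s <= T -> 0 < t <= T ->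
  M t - M s <= (1 + T) ^+ 2 * r * (t - s) ^+ 2.
Proof.
move=> /andP[s0 sT] /andP[t0 tT].
have [n1t _ ntT] := N_bound ler01 (ltW t0).
have [n1s _ _] := N_bound ler01 (ltW s0).
have x0 : 0 <= 1 + r * t * s.
  exact: addr_ge0 ler01 (mulr_ge0 (mulr_ge0 (ltW r_gt0) (ltW t0)) (ltW s0)).
have h2 : n t ^+ 2 * (1 + r * t * s) ^+ 2 <= n s ^+ 2 * D t ^+ 2.
  rewrite -!exprMn ler_sqr ?nnegrE; first exact: n_support.
    by rewrite mulr_ge0// (le_trans _ n1t).
  by rewrite mulr_ge0// ?(le_trans _ n1s)// ltW.
have id : (1 + r * t * s) ^+ 2 = D t * D s - r * (t - s) ^+ 2 by rewrite /D; ring.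
have Mt : M t <= (1 + T) ^+ 2.
  rewrite ler_pdivrMr// (le_trans (_ : _ <= (1 + T) ^+ 2))//.
    by rewrite ler_sqr ?nnegrE /n; lra.
  by rewrite ler_peMr// sqr_ge0.
have Ms : M s * (D t * D s) = n s ^+ 2 * D t by rewrite /M; field; rewrite gt_eqF.
have Mte : n t ^+ 2 = M t * D t by rewrite divfK// gt_eqF.
have h3 : M t * (D t * D s - r * (t - s) ^+ 2) <= M s * (D t * D s).
  rewrite Ms -(ler_pM2r (D_gt0 t)) -id.
  rewrite [leLHS]mulrAC -Mte (le_trans h2)//.
  by rewrite [D t ^+ 2]expr2 mulrA.
have q0 : 0 <= r * (t - s) ^+ 2 by rewrite mulr_ge0 ?sqr_ge0// ltW.
have DD : 1 <= D t * D s by rewrite mulr_ege1.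
have h4 : M t * (r * (t - s) ^+ 2) <= (1 + T) ^+ 2 * (r * (t - s) ^+ 2).
  by rewrite ler_wpM2r.
have h5 : (M t - M s) * (D t * D s) <= (1 + T) ^+ 2 * r * (t - s) ^+ 2.
  by rewrite -mulrA; lra.
have [M0|M0] := leP (M t - M s) 0.
  by rewrite (le_trans M0)// -mulrA mulr_ge0// sqr_ge0.
by apply: le_trans h5; rewrite ler_peMr// ltW.
Qed.

Let n_sqr t : 0 < t -> n t ^+ 2 = M 1 * D t.
Proof.
move=> t0; suff -> : M 1 = M t by rewrite divfK// gt_eqF.
apply: (@quadratic_increments_const M (1 + t) ((1 + (1 + t)) ^+ 2 * r)).
- by move=> x y xT yT; exact: M_increments.
- by rewrite ltr01/= lerDl ltW.
- by rewrite t0/= lerDr.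
Qed.

Let n_bound t : 0 < t -> [/\ 1 <= M 1 * D t, t ^+ 2 <= M 1 * D t &
  M 1 * D t <= (1 + t) ^+ 2].
Proof.
move=> t0; have [n1 nt n1t] := N_bound ler01 (ltW t0).
by rewrite -n_sqr//; move: n1 nt n1t; rewrite -/(n t) => *; split; nra.
Qed.

(** The limit of [n_bound] as [t] tends to 0, carried out with explicit small values of [t]. *)
Let M1 : M 1 = 1.
Proof.
set c := M 1.
have c0 : 0 < c.
  have [] := n_bound ltr01; rewrite -/c => c1 _ _.
  by rewrite -(pmulr_lgt0 _ (D_gt0 1)) (lt_le_trans ltr01).
apply/eqP; rewrite eq_le; apply/andP; split; rewrite leNgt; apply/negP => c1.
- pose t := Num.min 1 ((c - 1) / 4).
  have t0 : 0 < t by rewrite lt_min ltr01/= divr_gt0// subr_gt0.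
  have t1 : t <= 1 by rewrite ge_min lexx.
  have tc : t <= (c - 1) / 4 by rewrite ge_min lexx orbT.
  have [_ _] := n_bound t0; have := D_ge1 t; rewrite -/c.
  have : t ^+ 2 <= t by rewrite expr2 ler_piMr// ltW.
  by nra.
- have rc : 0 < r * c := mulr_gt0 r_gt0 c0.
  have rc2 : 0 < 2 * r * c by lra.
  have e0 : 0 < (1 - c) / (2 * r * c) by rewrite divr_gt0// subr_gt0.
  pose t := Num.min 1 ((1 - c) / (2 * r * c)).
  have t0 : 0 < t by rewrite lt_min ltr01.
  have t1 : t <= 1 by rewrite ge_min lexx.
  have tc : t * (2 * r * c) <= 1 - c.
    by rewrite -ler_pdivlMr// ge_min lexx orbT.
  have [+ _ _] := n_bound t0; rewrite -/c /D => h.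
  have t2 : t ^+ 2 <= t by rewrite expr2 ler_piMr// ltW.
  have : r * c * t ^+ 2 <= r * c * t by rewrite ler_pM2l.
  have : 0 < r * c * t := mulr_gt0 rc t0.
  by lra.
Qed.

(** The comparison of the coefficients of [t ^+ 2] in [n_bound], carried out with explicit large
    values of [t]. *)
Let r1 : r = 1.
Proof.
apply/eqP; rewrite eq_le; apply/andP; split; rewrite leNgt; apply/negP => c1.
- pose t := 3 / (r - 1).
  have t0 : 0 < t by rewrite divr_gt0// subr_gt0.
  have [_ _] := n_bound t0; rewrite M1 mul1r /D.
  have : (r - 1) * t = 3 by rewrite mulrC divfK// gt_eqF// subr_gt0.
  by nra.
- pose t := 2 / (1 - r).
  have t0 : 0 < t by rewrite divr_gt0// subr_gt0.
  have [_ + _] := n_bound t0; rewrite M1 mul1r /D.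
  have : (1 - r) * t = 2 by rewrite mulrC divfK// gt_eqF// subr_gt0.
  have : 2 <= t by rewrite ler_pdivlMr ?subr_gt0//; have := r_gt0; lra.
  by nra.
Qed.

(* The hypothesis on supporting functionals says that [N ^ 2] and the quadratic
   form [x ^ 2 + r y ^ 2], [r = al / be], have the same logarithmic gradient. *)
Lemma euclidean_norm x y : 0 <= x -> 0 <= y -> N x y ^+ 2 = x ^+ 2 + y ^+ 2.
Proof.
move=> x0 y0; have [x00|xn0] := eqVneq x 0.
  have [_ yN Ny] := N_bound x0 y0.
  have -> : N x y = y by apply/eqP; rewrite eq_le yN andbT; move: Ny; rewrite x00 add0r.
  by rewrite x00 expr0n add0r.
have [y00|yn0] := eqVneq y 0.
  have [xN _ Nx] := N_bound x0 y0.
  have -> : N x y = x by apply/eqP; rewrite eq_le xN andbT; move: Nx; rewrite y00 addr0.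
  by rewrite y00 expr0n addr0.
have {}x0 : 0 < x by rewrite lt_def xn0.
have {}y0 : 0 < y by rewrite lt_def yn0.
have t0 : 0 < y / x by rewrite divr_gt0.
have -> : N x y = x * n (y / x).
  by rewrite /n -N_homo ?ltW// mulr1 mulrC divfK.
by rewrite exprMn n_sqr// M1 /D r1; field.
Qed.

End planar_norms.

(** Each [z = c + w * a + w^-1 * b] is real: choosing [l] to align [l * z] with [n - z] gives
    [|n - z| + |z| <= n]. Taking [w] among 1, -1, i and -i shows that [b] is the conjugate of
    [a]. *)
Lemma complex_circle_norm (R : realType) (n c a b : R[i]) : 0 <= n ->
  (forall w l : R[i], `|w| = 1 -> `|l| = 1 ->
    `|n + (l - 1) * (c + w * a + w^-1 * b)| <= n) -> `|a| = `|b|.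
Proof.
move=> n0 H.
have imz z : (forall l : R[i], `|l| = 1 -> `|n + (l - 1) * z| <= n) -> complex.Im z = 0.
  move=> Hz.
  have [w1 w11 w1z] := rotation (n - z); have [w2 w21 w2z] := rotation z.
  have w10 : w1 != 0 by rewrite -normr_eq0 w11 oner_eq0.
  have l1 : `|w2 / w1| = 1 by rewrite normrM normfV w11 w21 divr1.
  have : `|n - z| + `|z| <= n.
    apply: le_trans (Hz _ l1); rewrite -[leRHS]mul1r -{1}w11 -normrM.
    have -> : w1 * (n + (w2 / w1 - 1) * z) = w1 * (n - z) + w2 * z by field.
    by rewrite w1z w2z ger0_norm// addr_ge0.
  move: n0; case: n {H Hz w1z} => n n' /ger0_Im /= ->; case: z {w2z l1} => x y.
  rewrite !normc_def /= -rmorphD /= lecR => h.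
  have s1 : n - x <= Num.sqrt ((n - x) ^+ 2 + (0 - y) ^+ 2).
    rewrite (le_trans (ler_norm _))// -sqrtr_sqr ler_wsqrtr// lerDl.
    exact: sqr_ge0.
  have s2 : Num.sqrt (x ^+ 2 + y ^+ 2) <= x by move: h; lra.
  have x0 : 0 <= x := le_trans (sqrtr_ge0 _) s2.
  have : x ^+ 2 + y ^+ 2 <= x ^+ 2.
    by rewrite -[leLHS]sqr_sqrtr ?addr_ge0 ?sqr_ge0// ler_sqr ?nnegrE ?sqrtr_ge0.
  rewrite gerDl => y2; apply/eqP; rewrite -sqrf_eq0 eq_le y2.
  exact: sqr_ge0.
have norm_i : `|'i%C : R[i]| = 1.
  by rewrite normc_def /= expr0n expr1n add0r sqrtr1.
have iV : ('i%C : R[i])^-1 = - 'i%C.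
  apply: (mulfI (_ : 'i%C != 0 :> R[i])); first by rewrite -normr_eq0 norm_i oner_eq0.
  rewrite divff; last by rewrite -normr_eq0 norm_i oner_eq0.
  by rewrite mulrN -expr2 sqr_i opprK.
have norm1C : `|1 : R[i]| = 1 by rewrite normr1.
have normN1C : `|-1 : R[i]| = 1 by rewrite normrN normr1.
have normNi : `|- 'i%C : R[i]| = 1 by rewrite normrN.
have h1 := imz _ (fun l => H _ l norm1C).
have h2 := imz _ (fun l => H _ l normN1C).
have h3 := imz _ (fun l => H _ l norm_i).
have h4 := imz _ (fun l => H _ l normNi).
have NiV : (- 'i%C : R[i])^-1 = 'i%C by rewrite invrN iV opprK.
move: h1 h2 h3 h4; rewrite invr1 (invrN 1) invr1 iV NiV.
case: a {H imz} => a1 a2; case: b => b1 b2; case: c => c1 c2 /=.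
move=> h1 h2 h3 h4; rewrite !normc_def /=.
have -> : a1 = b1 by lra.
have -> : a2 = - b2 by lra.
by rewrite sqrrN.
Qed.

Section rank_one_hermitian.
Variables (R : realType) (K : numFieldType) (S : real_structure R K).
Local Notation emb := (emb S).
Local Notation re := (re S).
Hypothesis circle_norm : forall n c a b : K, 0 <= n ->
  (forall w l : K, `|w| = 1 -> `|l| = 1 ->
    `|n + (l - 1) * (c + w * a + w^-1 * b)| <= n) -> `|a| = `|b|.
Variables (X1 X2 : normedModType K) (u1 : nat -> X1) (u2 : nat -> X2).
Hypotheses (us1 : unconditional_system u1) (us2 : unconditional_system u2).
Variables (J : {linear dual X1 -> dual X2}) (J' : {linear dual X2 -> dual X1}).
Hypotheses (J_isometry : surjective_isometry J) (J'_isometry : surjective_isometry J').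
Hypothesis J'K : cancel J' J.
Variables (i m l : nat).
Hypothesis ml : m != l.
Let f := J (coordf u1 i).
Let phi (h : dual X2) : K := J' h (u1 i).

(* Multiplying the [i]-th coordinate by [w] is an isometry of [dual X1]. *)
Lemma rotate_coord_norm (g : dual X1) (w : K) : `|w| = 1 ->
  dual_norm (g + ((w - 1) * g (u1 i)) *: coordf u1 i) <= dual_norm g.
Proof.
move=> w1; apply: (dual_norm_le_dense S us1); first exact: (dual_norm_ge0 S).
move=> A a.
rewrite dualD dualZ (coordf_fincomb S us1).
have -> : g (fincomb u1 A a) +
    (w - 1) * g (u1 i) * (if i \in A then a i else 0) =
    g (fincomb u1 A (fun k => if k == i then w * a k else a k)) :> K.
  rewrite !dual_fincomb; case: ifPn => iA.
    rewrite !(big_fsetD1 i iA) /= eqxx.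
    rewrite [X in w * a i * g (u1 i) + X](eq_big_seq (fun k => a k * g (u1 k))).
      by ring.
    by move=> k; rewrite !inE => /andP[/negbTE ->].
  rewrite mulr0 addr0; apply: eq_big_seq => k kA.
  by case: eqP => // ki; rewrite -ki kA in iA.
rewrite (le_trans (le_dual_norm S _ _))// ler_wpM2l ?(dual_norm_ge0 S)//.
apply: (us_mono us1) => k _; case: eqP => // _.
by rewrite normrM w1 mul1r.
Qed.

(** The coordinate rotation by [w], conjugated by [J], sends [h] to [h + ((w - 1) * phi h) *: f],
    still of norm at most 1; this functional is evaluated at [v]. *)
Lemma rank_one_rotation (h : dual X2) (v : X2) (w : K) : dual_norm h <= 1 ->
  h v = `|v| -> `|w| = 1 -> `| `|v| + (w - 1) * (phi h * f v)| <= `|v|.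
Proof.
move=> h1 hv w1.
pose g := J' h + ((w - 1) * phi h) *: coordf u1 i.
have Jg : J g v = `|v| + (w - 1) * (phi h * f v) :> K.
  have -> : J g = h + ((w - 1) * phi h) *: f by rewrite /g linearD linearZ /= J'K.
  by rewrite dualD dualZ hv mulrA.
rewrite -Jg (le_trans (le_dual_norm S _ _))// ler_piMl//.
by rewrite J_isometry.1 (le_trans (rotate_coord_norm _ w1))// J'_isometry.1.
Qed.

Let D : {fset nat} := [fset m; l]%fset.
Let pair (x y : K) k := if k == m then x else y.

Let sumD (V : zmodType) (F : nat -> V) : \sum_(k <- D) F k = F m + F l.
Proof. by rewrite big_fsetU1 ?inE//= big_seq_fset1. Qed.

Let pm x y : pair x y m = x. Proof. by rewrite /pair eqxx. Qed.
Let pl x y : pair x y l = y. Proof. by rewrite /pair eq_sym (negbTE ml). Qed.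

Let vec x y := fincomb u2 D (pair x y).

Let vecE x y : vec x y = x *: u2 m + y *: u2 l.
Proof. by rewrite /vec /fincomb sumD pm pl. Qed.

Let vec_norm x y x' y' : `|x| = `|x'| -> `|y| = `|y'| -> `|vec x y| = `|vec x' y'|.
Proof.
have le a b a' b' : `|a| = `|a'| -> `|b| = `|b'| -> `|vec a b| <= `|vec a' b'|.
  by move=> aa bb; apply: (us_mono us2) => k _; rewrite /pair; case: ifP => _; rewrite ?aa ?bb.
by move=> xx yy; apply/eqP; rewrite eq_le !le.
Qed.

Let Nr (x y : R) : R := re `|vec (emb x) (emb y)|.
Let al := re `|phi (coordf u2 m) * f (u2 l)|.
Let be := re `|phi (coordf u2 l) * f (u2 m)|.

Let Nr_homo c x y : 0 <= c -> 0 <= x -> 0 <= y -> Nr (c * x) (c * y) = c * Nr x y.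
Proof.
move=> c0 _ _; rewrite /Nr.
have -> : vec (emb (c * x)) (emb (c * y)) = emb c *: vec (emb x) (emb y).
  by rewrite !vecE scalerDr !scalerA !rmorphM.
by rewrite normrZ ger0_norm ?emb_ge0// re_embM.
Qed.

Let norm_emb x : 0 <= x -> re `|emb x| = x.
Proof. by move=> x0; rewrite ger0_norm ?emb_ge0// re_emb. Qed.

Let Nr_bound x y : 0 <= x -> 0 <= y -> [/\ x <= Nr x y, y <= Nr x y & Nr x y <= x + y].
Proof.
move=> x0 y0; split.
- rewrite -{1}(norm_emb x0) le_re// -[in leLHS](pm (emb x) (emb y)).
  by apply: (coord_le us2); rewrite !inE eqxx.
- rewrite -{1}(norm_emb y0) le_re// -[in leLHS](pl (emb x) (emb y)).
  by apply: (coord_le us2); rewrite !inE eqxx orbT.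
- rewrite -{2}(norm_emb x0) -{2}(norm_emb y0) -raddfD /= le_re// vecE.
  rewrite (le_trans (ler_normD _ _))// !normrZ (us_norm us2 m) (us_norm us2 l).
  by rewrite !mulr1.
Qed.

(** [P] and [Q] are the moduli of the coordinates of a functional [h] norming [v]; unconditionality
    allows the phases to be adjusted, which gives the bound for all [x] and [y]. *)
Let Nr_support s t : 0 < s -> 0 < t -> exists P Q,
  [/\ 0 <= P, 0 <= Q, Nr s t <= P * s + Q * t,
    forall x y, 0 <= x -> 0 <= y -> P * x + Q * y <= Nr x y &
    P * t * al = Q * s * be].
Proof.
move=> s0 t0; set v := vec (emb s) (emb t).
have [h [h1 hv]] := norming_functional S v.
pose p : K := h (u2 m); pose q : K := h (u2 l).
have hvec x y : h (vec x y) = x * p + y * q :> K.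
  by rewrite vecE dual_appD !dual_appZ.
exists (re `|p|), (re `|q|); split; try exact: re_norm_ge0.
- rewrite /Nr -/v -hv hvec raddfD /= !re_embM mulrC lerD//.
    by rewrite ler_wpM2r ?(ltW s0)// re_le_norm.
  by rewrite mulrC ler_wpM2r ?(ltW t0)// re_le_norm.
- move=> x y x0 y0.
  have [w1 w11 w1p] := rotation p; have [w2 w21 w2q] := rotation q.
  have -> : Nr x y = re `|vec (emb x * w1) (emb y * w2)|.
    by congr (re _); apply: vec_norm; rewrite normrM ?w11 ?w21 mulr1.
  apply: le_trans (ball_le S _ h1); rewrite hvec -!mulrA w1p w2q.
  apply: le_trans (re_le_norm S _); rewrite raddfD /= !re_embM.
  by rewrite (mulrC x) (mulrC y).
(* Rotating the second coordinate of [v] by [w] and that of [h] by [w^-1] keeps the pair norming.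
   What [rank_one_rotation] controls then has the form required by [circle_norm]. *)
- have key : `|emb t * p * (phi (coordf u2 m) * f (u2 l))| =
      `|emb s * q * (phi (coordf u2 l) * f (u2 m))|.
    apply: (circle_norm (n := `|v|) (c := emb s * p * (phi (coordf u2 m) * f (u2 m)) +
      emb t * q * (phi (coordf u2 l) * f (u2 l)))) => // w z w1 z1.
    have w0 : w != 0 by rewrite -normr_eq0 w1 oner_eq0.
    pose hw : dual X2 := \sum_(k <- D) pair p (w^-1 * q) k *: coordf u2 k.
    have hw1 : dual_norm hw <= 1.
      apply/(dual_norm_sum_coordf S us2) => // x.
      have -> : \sum_(k <- D) pair p (w^-1 * q) k * x k =
          h (vec (x m) (w^-1 * x l)) :> K.
        by rewrite sumD pm pl hvec; ring.
      rewrite (le_trans (le_dual_norm S _ _))// ler_pM ?(dual_norm_ge0 S)//.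
      have -> : fincomb u2 D x = vec (x m) (x l).
        by rewrite vecE /fincomb sumD.
      rewrite (vec_norm (x' := x m) (y' := x l))// normrM normfV w1.
      by rewrite invr1 mul1r.
    have hwE x : hw x = p * coordf u2 m x + w^-1 * q * coordf u2 l x :> K.
      by rewrite dual_sum sumD !dualZ pm pl.
    pose vw := vec (emb s) (w * emb t).
    have vwn : `|vw| = `|v|.
      by apply: vec_norm => //; rewrite normrM w1 mul1r.
    have hwv : hw vw = `|vw|.
      rewrite vwn -hv hvec hwE !(coordf_fincomb S us2) pm pl !inE !eqxx orbT /=.
      by field.
    have := rank_one_rotation hw1 hwv z1; rewrite vwn.
    have -> : phi hw = p * phi (coordf u2 m) + w^-1 * q * phi (coordf u2 l).
      by rewrite /phi /hw sumD pm pl linearD !linearZ.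
    have -> : f vw = emb s * f (u2 m) + w * emb t * f (u2 l) :> K.
      by rewrite /vw vecE dual_appD !dual_appZ.
    congr (`|_ + _ * _| <= _); field.
    exact: w0.
  have es0 : `|emb s| = emb s by rewrite ger0_norm// emb_ge0 ltW.
  have et0 : `|emb t| = emb t by rewrite ger0_norm// emb_ge0 ltW.
  have := congr1 re key; rewrite !(normrM (_ * _)) !(normrM (emb _)) es0 et0.
  by rewrite -!mulrA !re_embM !re_mulnorm// -/al -/be; lra.
Qed.

(* The operator [h |-> phi h *: f] generates the group of isometries of
   [rank_one_rotation]; its numerical range is real, which links the supporting
   functionals of the span of [u2 m] and [u2 l] to [al] and [be]. *)
Lemma rank_one_euclidean x y : 0 < be ->
  `|x *: u2 m + y *: u2 l| ^+ 2 = `|x| ^+ 2 + `|y| ^+ 2.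
Proof.
move=> be0; rewrite -vecE.
have al0 : 0 <= al by exact: re_norm_ge0.
have := euclidean_norm Nr_homo Nr_bound al0 be0 Nr_support
  (re_norm_ge0 S x) (re_norm_ge0 S y).
move=> /(congr1 emb); rewrite rmorphD !rmorphXn /= !emb_norm /Nr !emb_normv => <-.
by congr (_ ^+ 2); apply: vec_norm; rewrite normr_id.
Qed.

End rank_one_hermitian.

Section euclidean_dual.
Variables (R : realType) (K : numFieldType) (S : real_structure R K).
Local Notation emb := (emb S).
Local Notation re := (re S).
Variables (X : normedModType K) (u : nat -> X).
Hypothesis us : unconditional_system u.
Variables m l : nat.
Hypothesis ml : m != l.

Let sumD (V : zmodType) (F : nat -> V) :
  \sum_(k <- [fset m; l]%fset) F k = F m + F l.
Proof. by rewrite big_fsetU1 ?inE//= big_seq_fset1. Qed.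

(** Cauchy-Schwarz gives the upper bound, and the vector of conjugate coefficients attains it. *)
Lemma euclidean_dual :
  (forall x y : K, `|x *: u m + y *: u l| ^+ 2 = `|x| ^+ 2 + `|y| ^+ 2) ->
  isometrically_l2_2 (coordf u m) (coordf u l).
Proof.
move=> eucl a b.
have lm : (l == m) = false by rewrite eq_sym (negbTE ml).
pose ab k := if k == m then a else b.
have -> : a *: coordf u m + b *: coordf u l =
    \sum_(k <- [fset m; l]%fset) ab k *: coordf u k.
  by rewrite sumD /ab eqxx lm.
set h := \sum_(k <- _) _; pose n2 := `|a| ^+ 2 + `|b| ^+ 2.
have n20 : 0 <= n2 by rewrite addr_ge0// exprn_ge0.
pose c := emb (Num.sqrt (re n2)).
have c0 : 0 <= c by rewrite emb_ge0 sqrtr_ge0.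
have c2 : c ^+ 2 = n2.
  by rewrite -rmorphXn /= sqr_sqrtr ?re_ge0K// -(emb_ge0 S) re_ge0K.
suff -> : dual_norm h = c by [].
apply/eqP; rewrite eq_le; apply/andP; split.
  apply/(dual_norm_sum_coordf S us) => // x; rewrite /fincomb !sumD /ab eqxx lm.
  rewrite -ler_sqr ?nnegrE ?mulr_ge0// exprMn c2 eucl.
  have : `|a * x m + b * x l| ^+ 2 <= (`|a| * `|x m| + `|b| * `|x l|) ^+ 2.
    by rewrite ler_sqr ?nnegrE ?addr_ge0 ?mulr_ge0// -!normrM ler_normD.
  move=> /le_trans; apply; rewrite -subr_ge0.
  (* Lagrange's identity: the defect in Cauchy-Schwarz is a square. *)
  have -> : n2 * (`|x m| ^+ 2 + `|x l| ^+ 2) - (`|a| * `|x m| + `|b| * `|x l|) ^+ 2 =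
    (`|a| * `|x l| - `|b| * `|x m|) ^+ 2 by rewrite /n2; ring.
  by rewrite real_exprn_even_ge0// rpredB// rpredM// normr_real.
have [w wn wa] := rotation a; have [z zn zb] := rotation b.
(* Since [w * a] is the modulus of [a], these are the conjugates of [a] and [b], written without a
   conjugation on [K]. *)
pose x k := if k == m then w * `|a| else z * `|b|.
have := (dual_norm_sum_coordf S us [fset m; l]%fset ab (dual_norm_ge0 S h)).1
  (lexx _) x.
rewrite /fincomb !sumD /ab /x eqxx lm.
have -> : a * (w * `|a|) + b * (z * `|b|) = n2.
  by rewrite !mulrA (mulrC a) (mulrC b) wa zb -!expr2.
have -> : `|(w * `|a|) *: u m + (z * `|b|) *: u l| = c.
  apply/eqP; rewrite -(@eqrXn2 _ 2)//; apply/eqP.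
  by rewrite eucl c2 !normrM wn zn !mul1r !normr_id.
rewrite ger0_norm// -c2 expr2.
have [->|cn0] := eqVneq c 0; first by rewrite (dual_norm_ge0 S).
by rewrite ler_pM2r// lt_def cn0.
Qed.

End euclidean_dual.

Section complex_isometries.
Variables (R : realType) (K : numFieldType) (S : real_structure R K).
Hypothesis circle_norm : forall n c a b : K, 0 <= n ->
  (forall w l : K, `|w| = 1 -> `|l| = 1 ->
    `|n + (l - 1) * (c + w * a + w^-1 * b)| <= n) -> `|a| = `|b|.
Variables (E : normedModType K) (e : nat -> E).
Hypothesis es : unconditional_system e.
Hypothesis e_strict : strictly_one_unconditional e.
Hypothesis e_extreme : extreme_points_not_covered e.
Variables (F1 F2 : set {fset nat}).
Hypotheses (F1_comb : combinatorial_family F1) (F2_comb : combinatorial_family F2).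
Hypotheses (F1_compact : compact_family F1) (F2_compact : compact_family F2).
Variables (X1 X2 : completeNormedModType K) (u1 : nat -> X1) (u2 : nat -> X2).
Hypotheses (X1_space : is_family_space e F1 u1) (X2_space : is_family_space e F2 u2).
Variables (J : {linear dual X1 -> dual X2}) (J' : {linear dual X2 -> dual X1}).
Hypotheses (J_isometry : surjective_isometry J) (J'_isometry : surjective_isometry J').
Hypotheses (JK : cancel J J') (J'K : cancel J' J).

Let us1 := family_system S es F1_comb X1_space.
Let us2 := family_system S es F2_comb X2_space.

(** The [i]-th coordinate of [J' f] is 1, so expanding [f] over [B] yields a support point [l] with
    [J' (coordf u2 l)] nonzero at [u1 i]. A second support point [m] makes [rank_one_euclidean]
    applicable, and as [m] and [l] share a member of [F2], the Euclidean norm obtained is that of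
    [E]. *)
Lemma complex_singly_supported (A : {fset nat}) i : no_l2_2_span e ->
  maximal_in F1 A -> i \in A -> singly_supported u2 (J (coordf u1 i)).
Proof.
move=> no_l2 Amax iA k1 k2 k12 Jk1; apply: contrapT => Jk2.
have [B [[FB _] JB _]] := isometry_maximal S es e_strict e_extreme F1_comb F2_comb
  F1_compact F2_compact X1_space X2_space J_isometry J'_isometry JK Amax.
set f := J (coordf u1 i) in Jk1 Jk2.
have fB : supported_in u2 B f := JB _ (coordf_supported S us1 iA).
have sum1 : \sum_(k <- B) f (u2 k) * J' (coordf u2 k) (u1 i) = 1 :> K.
  have : J' f (u1 i) = 1 by rewrite JK (coordf_eval S us1) eqxx.
  rewrite {1}(supported_inE S us2 fB) linear_sum dual_sum => <-.
  by apply: eq_bigr => k _; rewrite linearZ.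
have [l lB fl] : exists2 l, l \in B & f (u2 l) * J' (coordf u2 l) (u1 i) != 0 :> K.
  apply: contrapT => /forall2NP f0; move: sum1; rewrite big_seq big1.
    by move=> /esym/eqP; rewrite oner_eq0.
  by move=> k kB; have [//|/negP/negPn/eqP] := f0 k.
move: fl; rewrite mulf_eq0 negb_or => /andP[fl phil].
have [m ml /eqP fm] : exists2 m, m != l & f (u2 m) <> 0.
  have [k1l|k1l] := eqVneq k1 l; last by exists k1.
  by exists k2 => //; rewrite -k1l; apply/eqP => k21; exact: k12.
have mB : m \in B by apply: contraNT fm => mB; rewrite fB.
have be0 : 0 < re S `|J' (coordf u2 l) (u1 i) * f (u2 m) : K|.
  by rewrite -(emb_lt S) rmorph0 emb_norm normr_gt0 mulf_neq0.
have FD : F2 [fset m; l]%fset.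
  by apply: F2_comb.2 FB; rewrite fsubUset !fsub1set mB.
apply: (no_l2 m l); first exact/eqP.
apply: (euclidean_dual S es ml) => x y.
have := rank_one_euclidean circle_norm us1 us2 J_isometry J'_isometry J'K ml x y be0.
move=> <-; congr (_ ^+ 2).
have := family_norm_mem S es F2_comb X2_space (fun k => if k == m then x else y) FD.
rewrite /fincomb !big_fsetU1 ?inE//= !big_seq_fset1 eqxx.
by rewrite eq_sym (negbTE ml) => ->.
Qed.

End complex_isometries.

(** * Conclusion for real and complex scalars *)

Section signed_permutations.
Variables (R : realType) (K : numFieldType) (S : real_structure R K).
Variables (E : normedModType K) (e : nat -> E).
Hypothesis es : unconditional_system e.
Hypothesis e_strict : strictly_one_unconditional e.
Hypothesis e_extreme : extreme_points_not_covered e.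
(** Quantified over all families and spaces, since it is applied both to an isometry and to its
    inverse. *)
Hypothesis e_single : forall (F1 F2 : set {fset nat}),
  combinatorial_family F1 -> combinatorial_family F2 ->
  compact_family F1 -> compact_family F2 ->
  forall (X1 X2 : completeNormedModType K) (u1 : nat -> X1) (u2 : nat -> X2),
  is_family_space e F1 u1 -> is_family_space e F2 u2 ->
  forall (J : {linear dual X1 -> dual X2}) (J' : {linear dual X2 -> dual X1}),
  surjective_isometry J -> surjective_isometry J' -> cancel J J' -> cancel J' J ->
  forall A i, maximal_in F1 A -> i \in A -> singly_supported u2 (J (coordf u1 i)).

Lemma isometry_signed_permutation (F1 F2 : set {fset nat})
    (X1 X2 : completeNormedModType K) (u1 : nat -> X1) (u2 : nat -> X2)
    (J : {linear dual X1 -> dual X2}) :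
  combinatorial_family F1 -> combinatorial_family F2 ->
  compact_family F1 -> compact_family F2 ->
  is_family_space e F1 u1 -> is_family_space e F2 u2 ->
  surjective_isometry J -> compatible_signed_permutation F1 F2 u1 u2 J.
Proof.
move=> F1c F2c F1k F2k X1s X2s Ji.
have [J' [J'i JK J'K]] := isometry_inverse S Ji.
apply: (monomial_compatible S (family_system S es F1c X1s)
  (family_system S es F2c X2s) F1c F2c F1k F2k JK J'K) => A Amax.
- apply: (monomial_image S es e_strict e_extreme F1c F2c F1k F2k X1s X2s Ji J'i JK) => //.
  by move=> i iA; exact: (e_single F1c F2c F1k F2k X1s X2s Ji J'i JK J'K Amax iA).
- apply: (monomial_image S es e_strict e_extreme F2c F1c F2k F1k X2s X1s J'i Ji J'K) => //.
  by move=> i iA; exact: (e_single F2c F1c F2k F1k X2s X1s J'i Ji J'K JK Amax iA).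
Qed.

End signed_permutations.

Theorem theorem2p16 (R : realType) (K : numFieldType)
    (E : completeNormedModType K) (e : nat -> E)
    (e_basis : schauder_basis e)
    (e_normalized : normalized e)
    (e_unconditional : one_unconditional e)
    (e_strict : strictly_one_unconditional e)
    (e_scalars :
      (K = R :> numFieldType /\ embeddings_disjoint_supports e) \/
      (K = R[i] :> numFieldType /\ no_l2_2_span e))
    (e_extreme : extreme_points_not_covered e)
    (F1 F2 : set {fset nat})
    (F1_comb : combinatorial_family F1) (F1_compact : compact_family F1)
    (F2_comb : combinatorial_family F2) (F2_compact : compact_family F2)
    (X1 X2 : completeNormedModType K) (u1 : nat -> X1) (u2 : nat -> X2)
    (X1_space : is_family_space e F1 u1) (X2_space : is_family_space e F2 u2)
    (J : {linear dual X1 -> dual X2})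
    (J_isometry : surjective_isometry J) :
  compatible_signed_permutation F1 F2 u1 u2 J.
Proof.
(* Once the field is fixed, its [real_structure] is available; the two cases differ only in how
   single supports are obtained. *)
case: e_scalars => -[KE e_cond]; subst K.
- have es := basis_system e_basis e_normalized e_unconditional e_strict.
  apply: (isometry_signed_permutation (real_structure_real R) es e_strict e_extreme) => //.
  move=> G1 G2 G1c G2c G1k G2k Y1 Y2 v1 v2 Y1s Y2s L L' Li L'i LK L'K A i.
  exact: (real_singly_supported (real_structure_real R) es e_strict e_extreme G1c G2c
    G1k G2k Y1s Y2s Li L'i LK L'K e_cond).
- have es := basis_system e_basis e_normalized e_unconditional e_strict.
  apply: (isometry_signed_permutation (real_structure_complex R) es e_strict e_extreme) => //.
  move=> G1 G2 G1c G2c G1k G2k Y1 Y2 v1 v2 Y1s Y2s L L' Li L'i LK L'K A i.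
  exact: (complex_singly_supported (real_structure_complex R) (@complex_circle_norm R)
    es e_strict e_extreme G1c G2c G1k G2k Y1s Y2s Li L'i LK L'K e_cond).
Qed.
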